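(* Let $d\ge2$ and let $\mathcal{E}\subset\mathbb{S}^{d-1}$ be a set of directions such that $\operatorname{span}(\mathcal{E})=\mathbb{R}^d$. Then $w_r(\Omega;\mathcal{E})_p<\infty$ for every $r\in\mathbb{N}$, every $0<p\le\infty$ and every convex body $\Omega\subset\mathbb{R}^d$ if and only if $\overline{\mathcal{E}\cup(-\mathcal{E})}=\mathbb{S}^{d-1}$.
   Context: Notation. $\|\cdot\|$ is the Euclidean norm, $\mathbb{S}^{d-1}=\{x\in\mathbb{R}^d:\|x\|=1\}$, $\mathbb{N}=\{1,2,\dots\}$. A convex body in $\mathbb{R}^d$ is a compact convex subset with nonempty interior. For $0<p<\infty$, $L^p(\Omega)$ is the usual Lebesgue space; $L^\infty(\Omega):=C(\overline{\Omega})$ with the uniform norm. For a nonempty bounded measurable set $\Omega\subset\mathbb{R}^d$, $h\in\mathbb{R}^d\setminus\{0\}$ and $r\in\mathbb{N}$ put $\Omega_{r,h}:=\{x\in\Omega: x,x+h,\dots,x+rh\in\Omega\}$ and $\triangle_h^r f(x):=\sum_{j=0}^r(-1)^{r+j}\binom{r}{j}f(x+jh)$ for $x\in\Omega_{r,h}$. For $\xi\in\mathbb{S}^{d-1}$, $t>0$, $0<p\le\infty$ let $\omega_\xi^r(f,t)_{L^p(\Omega)}:=\sup_{|u|\le t}\|\triangle_{u\xi}^rf\|_{L^p(\Omega_{r,u\xi})}$ (the norm over an empty set is $0$). For a nonempty $\mathcal{E}\subset\mathbb{S}^{d-1}$ let $\omega^r_{\mathcal{E}}(f;\Omega)_p:=\sup_{\xi\in\mathcal{E}}\omega^r_\xi(f,\operatorname{diam}(\Omega))_{L^p(\Omega)}$.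 $\Pi^d_{r-1}(\mathcal{E})$ is the set of all real continuous functions $Q$ on $\mathbb{R}^d$ such that for every fixed $x\in\mathbb{R}^d$ and $\xi\in\mathcal{E}$ the function $t\mapsto Q(x+t\xi)$ is an algebraic polynomial of degree $<r$ in $t\in\mathbb{R}$. Set $E_r(f;\mathcal{E})_{L^p(\Omega)}:=\inf\{\|f-Q\|_{L^p(\Omega)}:Q\in\Pi^d_{r-1}(\mathcal{E})\}$. The directional Whitney constant is $w_r(\Omega;\mathcal{E})_p:=\sup\{E_r(f;\mathcal{E})_{L^p(\Omega)}: f\in L^p(\Omega),\ \omega^r_{\mathcal{E}}(f;\Omega)_p\le 1\}\in[0,\infty]$. *)

(* Defs.v *)
From HB Require Import structures.
From mathcomp Require Import all_boot all_order all_algebra.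
From mathcomp Require Import all_classical all_reals all_analysis.

Set Implicit Arguments.
Unset Strict Implicit.
Unset Printing Implicit Defensive.
Import Order.TTheory GRing.Theory Num.Theory.
Import numFieldNormedType.Exports.

Local Open Scope classical_set_scope.
Local Open Scope ring_scope.

Definition rV_display : measure_display.
Proof. exact. Qed.

Section measurable_rV.
Context {R : realType} (n : nat).

Definition rV_coor (i : 'I_n) (x : 'rV[R]_n) : R := x ord0 i.

(* The product sigma-algebra, which is the Borel one (open_measurable_rV). *)
Definition rV_measurable : set (set 'rV[R]_n) := g_sigma_preimage rV_coor.

Let rV_measurable0 : rV_measurable set0.
Proof. exact: sigma_algebra0. Qed.

Let rV_measurableC A : rV_measurable A -> rV_measurable (~` A).
Proof. exact: sigma_algebraC. Qed.

Let rV_measurable_bigcup (F : (set 'rV[R]_n)^nat) :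
  (forall i, rV_measurable (F i)) -> rV_measurable (\bigcup_i (F i)).
Proof. exact: sigma_algebra_bigcup. Qed.

HB.instance Definition _ := @isMeasurable.Build rV_display
  'rV[R]_n rV_measurable rV_measurable0 rV_measurableC rV_measurable_bigcup.

End measurable_rV.

Lemma measurable_rV_coor (R : realType) n (i : 'I_n) :
  measurable_fun [set: 'rV[R]_n] (rV_coor i).
Proof.
move=> _ Y mY; rewrite setTI; apply: sub_sigma_algebra => /=.
rewrite -bigcup_seq/=; exists i => /=; first by rewrite mem_index_enum.
by exists Y => //; rewrite setTI.
Qed.

Lemma measurable_rV_box (R : realType) n (A : 'I_n -> set R) :
  (forall i, measurable (A i)) ->
  measurable [set x : 'rV[R]_n | forall i, A i (x ord0 i)].
Proof.
move=> mA.
rewrite (_ : mkset _ = \big[setI/setT]_i (rV_coor i @^-1` A i)).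
  apply: bigsetI_measurable => i _.
  by rewrite -[X in measurable X]setTI; exact: measurable_rV_coor.
apply/seteqP; split => x; rewrite -bigcap_seq.
  by move=> Ax i _; exact: Ax.
by move=> Ax i; apply: Ax => /=; rewrite mem_index_enum.
Qed.

Lemma open_measurable_rV (R : realType) n (U : set 'rV[R]_n) :
  open U -> measurable U.
Proof.
move=> oU.
pose B (z : 'rV[rat]_n * nat) : set 'rV[R]_n :=
  [set x | forall i, ball (ratr (z.1 ord0 i) : R) z.2.+1%:R^-1 (x ord0 i)].
rewrite (_ : U = \bigcup_(z in [set z | B z `<=` U]) B z).
  rewrite bigcup_mkcond; apply: countable_bigcupT_measurable => [|z]; first exact: countableP.
  case: ifP => // _.
  apply: (@measurable_rV_box R n
    (fun i => ball (ratr (z.1 ord0 i) : R) z.2.+1%:R^-1)) => i.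
  exact: measurable_realfun.measurable_ball.
apply/seteqP; split => [x Ux|x [z BU Bx]]; last exact: BU.
have /nbhs_ballP[e /= e0 xeU] : nbhs x U by exact: open_nbhs_nbhs.
have e20 : 0 < e / 2 by rewrite divr_gt0.
have [k _ /(_ k (leqnn k)) /= ke] := near_infty_natSinv_lt (PosNum e20).
have /choice[q qx] i : exists q : rat, ball (ratr q : R) k.+1%:R^-1 (x ord0 i).
  have k0 : 0 < k.+1%:R^-1 :> R by rewrite invr_gt0.
  have [q] : exists q, ratr q \in `]x ord0 i - k.+1%:R^-1, x ord0 i + k.+1%:R^-1[.
    by apply: rat_in_itvoo; rewrite ltrBlDr -addrA ltrDl addr_gt0.
  rewrite in_itv/= => /andP[q1 q2]; exists q.
  by rewrite /ball/= ltr_distl ltrBlDr q2 -ltrBlDr q1.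
exists (\row_i q i, k) => [y By|i]; last by rewrite mxE; exact: qx.
apply: xeU; split=> // i j; rewrite ord1 [e]splitr.
apply: (ball_triangle (y := (ratr (q j) : R))).
  by apply: ball_sym; apply: le_ball (qx j); exact: ltW.
by have := By j; rewrite mxE; apply: le_ball; exact: ltW.
Qed.

Lemma measurable_fun_rV d (T : measurableType d) (R : realType) n
    (f : T -> 'rV[R]_n) :
  (forall i, measurable_fun [set: T] (rV_coor i \o f)) ->
  measurable_fun [set: T] f.
Proof.
move=> mf _ A; rewrite setTI; move: A.
suff: (@measurable _ 'rV[R]_n) `<=` image_set_system [set: T] f measurable.
  by move=> + A mA => /(_ _ mA); rewrite /image_set_system/= setTI.
apply: smallest_sub; first exact/sigma_algebra_image/sigma_algebra_measurable.
rewrite -bigcup_seq/=; apply: bigcup_sub => i _ A [B mB <-] /=.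
rewrite /image_set_system/= !setTI.
by have := mf i measurableT B mB; rewrite setTI.
Qed.

Section cons_rV.
Context {R : realType} (n : nat).

Definition cons_rV (z : R * 'rV[R]_n) : 'rV[R]_n.+1 :=
  row_mx (const_mx z.1 : 'rV_1) z.2.

Lemma measurable_cons_rV : measurable_fun setT cons_rV.
Proof.
apply: measurable_fun_rV => i.
have [k|k] := split_ordP (i : 'I_(1 + n)) => ->.
- rewrite (_ : _ \o _ = fst) //; apply/funext => z /=.
  by rewrite /rV_coor /cons_rV [LHS]row_mxEl mxE.
- rewrite (_ : _ \o _ = rV_coor k \o snd).
    by apply: measurableT_comp => //; exact: measurable_rV_coor.
  by apply/funext => z /=; exact: row_mxEr.
Qed.

Definition uncons_rV (x : 'rV[R]_n.+1) : R * 'rV[R]_n :=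
  (x ord0 ord0, \row_i x ord0 (rshift 1 i)).

Lemma measurable_uncons_rV : measurable_fun setT uncons_rV.
Proof.
apply/measurable_fun_pairP; split; first exact: (measurable_rV_coor ord0).
apply: measurable_fun_rV => i.
rewrite (_ : _ \o _ = rV_coor (rshift 1 i : 'I_n.+1)).
  exact: measurable_rV_coor.
by apply/funext => x /=; rewrite /rV_coor mxE.
Qed.

Lemma cons_rV0 z : cons_rV z ord0 ord0 = z.1.
Proof.
have -> : (ord0 : 'I_n.+1) = lshift n (ord0 : 'I_1) by exact/val_inj.
by rewrite [LHS]row_mxEl mxE.
Qed.

Lemma cons_rVS z i : cons_rV z ord0 (rshift 1 i) = z.2 ord0 i.
Proof. exact: row_mxEr. Qed.

Lemma cons_rVK : cancel cons_rV uncons_rV.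
Proof.
move=> [a x]; congr pair; first exact: cons_rV0.
by apply/rowP => i; rewrite mxE cons_rVS.
Qed.

End cons_rV.

Section lebesgue_cons.
Context {R : realType} (n : nat)
  (mu : {sigma_finite_measure set 'rV[R]_n -> \bar R}).
Local Open Scope ereal_scope.

Definition lebesgue_cons : set 'rV[R]_n.+1 -> \bar R :=
  pushforward (@lebesgue_measure R \x mu) (@cons_rV R n).

Let lebesgue_cons_measure : {measure set 'rV[R]_n.+1 -> \bar R} :=
  measure_function_pushforward__canonical__measure_function_Measure
    (@lebesgue_measure R \x mu) (@measurable_cons_rV R n).

HB.instance Definition _ := Measure.copy lebesgue_cons lebesgue_cons_measure.

Let lebesgue_cons_sigma_finite : sigma_finite setT lebesgue_cons.
Proof.
have /sigma_finiteP[F [UF ndF Foo]] := sigma_finiteT (@lebesgue_measure R).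
have /sigma_finiteP[G [UG ndG Goo]] := sigma_finiteT mu.
exists (fun k => (@uncons_rV R n) @^-1` (F k `*` G k)).
  apply/seteqP; split=> // x _.
  have [i _ Fi] : (\bigcup_i F i) (uncons_rV x).1 by rewrite -UF.
  have [j _ Gj] : (\bigcup_i G i) (uncons_rV x).2 by rewrite -UG.
  exists (maxn i j) => //; split.
    by move: Fi; exact/subsetPset/ndF/leq_maxl.
  by move: Gj; exact/subsetPset/ndG/leq_maxr.
move=> k; have [mF Fk] := Foo k; have [mG Gk] := Goo k; split.
  rewrite -[X in measurable X]setTI; apply: measurable_uncons_rV => //.
  exact: measurableX.
rewrite /lebesgue_cons /pushforward.
rewrite (_ : _ @^-1` _ = F k `*` G k).
  by rewrite product_measure1E// lte_mul_pinfty// ge0_fin_numE.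
by apply/funext => z; rewrite /preimage /mkset cons_rVK.
Qed.

HB.instance Definition _ := @Measure_isSigmaFinite.Build _ _ _
  lebesgue_cons lebesgue_cons_sigma_finite.

End lebesgue_cons.

Fixpoint lebesgue_rV (R : realType) n :
    {sigma_finite_measure set 'rV[R]_n -> \bar R} :=
  if n is m.+1 then lebesgue_cons (lebesgue_rV R m) else \d_(0 : 'rV[R]_0).

Lemma lebesgue_rV_box (R : realType) n (A : 'I_n -> set R) :
  (forall i, measurable (A i)) ->
  lebesgue_rV R n [set x | forall i, A i (x ord0 i)] =
  (\prod_(i < n) lebesgue_measure (A i))%E.
Proof.
elim: n A => [|n IH] A mA.
  rewrite big_ord0 /= diracE mem_set//; by case.
rewrite big_ord_recl /= /lebesgue_cons /pushforward.
pose B := [set x : 'rV[R]_n | forall i, A (lift ord0 i) (x ord0 i)].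
have mB : measurable B.
  exact: (@measurable_rV_box R n (fun i => A (lift ord0 i))).
have liftE i : lift ord0 i = rshift 1 i :> 'I_n.+1 by exact/val_inj.
transitivity ((@lebesgue_measure R \x lebesgue_rV R n)%E (A ord0 `*` B)).
  congr (_ _); apply/seteqP; split => [z /= Az|z [/= A0 Bz] i].
    split => [|i]; first by rewrite -cons_rV0; exact: Az.
    by rewrite -cons_rVS -liftE; exact: Az.
  have [j ->|->] := unliftP ord0 i; last by rewrite cons_rV0.
  by rewrite liftE cons_rVS -liftE; exact: Bz.
rewrite product_measure1E//; last exact: mA.
by congr (_ * _)%E; exact: IH.
Qed.

Section whitney.
Context {R : realType} {d : nat}.
Local Notation V := 'rV[R]_d.
Implicit Types (x h xi : V) (A Omega E : set V) (f Q : V -> R).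
Implicit Types (r : nat) (p : \bar R) (t : R).

(* The library norm on 'rV is the sup norm. *)
Definition enorm x : R := Num.sqrt (\sum_i x ord0 i ^+ 2).

Definition sphere : set V := [set x | enorm x = 1].

Definition diam A : R := sup [set enorm (x - y) | x in A & y in A].

Definition lin_span E : set V :=
  [set x | exists2 s : seq V, {in s, forall e, E e} & x \in << s >>%VS].

Definition convex_body Omega : Prop :=
  [/\ compact Omega, convex_set Omega & Omega° !=set0].

(* For p = +oo this is the supremum, and not the essential supremum, since
   L^oo(Omega) stands for C(closure Omega). The value at -oo is irrelevant. *)
Definition Lp_norm A p f : \bar R :=
  match p with
  | q%:E => ((\int[lebesgue_rV R d]_(x in A) (`|f x| `^ q)%:E) `^ q^-1)%E
  | +oo%E => ereal_sup ([set 0%E] `|` [set `|f x|%:E | x in A])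
  | -oo%E => 0%E
  end.

(* Representatives of the elements of L^p(Omega), of which only the values on
   Omega matter. For p finite they are taken Borel measurable, as every class
   of Lebesgue measurable functions contains one. *)
Definition Lp Omega p : set (V -> R) :=
  if p == +oo%E then [set f | {within closure Omega, continuous f}]
  else [set f | measurable_fun Omega f /\ (Lp_norm Omega p f < +oo)%E].

Definition diff_dom Omega r h : set V :=
  [set x | forall j, (j <= r)%N -> Omega (x + h *+ j)].

Definition finite_diff r h f x : R :=
  \sum_(j < r.+1) (-1) ^+ (r + j) * 'C(r, j)%:R * f (x + h *+ j).

Definition modulus r xi f t Omega p : \bar R :=
  ereal_sup [set Lp_norm (diff_dom Omega r (u *: xi)) p (finite_diff r (u *: xi) f)
            | u in [set u : R | `|u| <= t]].

Definition dir_modulus r E f Omega p : \bar R :=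
  ereal_sup [set modulus r xi f (diam Omega) Omega p | xi in E].

Definition dir_poly r E : set (V -> R) :=
  [set Q | continuous Q /\ forall x xi, E xi ->
    exists2 q : {poly R}, (size q <= r)%N & forall t, Q (x + t *: xi) = q.[t]].

Definition dir_dist r f E Omega p : \bar R :=
  ereal_inf [set Lp_norm Omega p (f \- Q) | Q in dir_poly r E].

Definition whitney_const r Omega E p : \bar R :=
  ereal_sup [set dir_dist r f E Omega p |
    f in [set f | Lp Omega p f /\ (dir_modulus r E f Omega p <= 1)%E]].

End whitney.

(* Main.v *)
Require Import Defs.
From HB Require Import structures.
From mathcomp Require Import all_boot all_order all_algebra.
From mathcomp Require Import all_classical all_reals all_analysis.
From mathcomp Require Import measurable_realfun ring lra zify.
Import Order.TTheory GRing.Theory Num.Theory.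
Import numFieldNormedType.Exports.
Local Open Scope classical_set_scope.
Local Open Scope ring_scope.

Set Implicit Arguments.
Unset Strict Implicit.
Unset Printing Implicit Defensive.

(** If [E] and [- E] together are not dense in the sphere, pick [xi0] in the
    sphere away from their closure, and let [ell] be the scalar product with
    [xi0]. On a thin cone with vertex [0] and axis [xi0], two points that differ
    by a multiple of some [xi] in [E] have comparable values of [ell], so
    [ln (ell + exp (- n))] has first differences along [E] bounded by [ln 2],
    while its oscillation is at least [n].

    Conversely, measure [f] by the integral of [`|f| `^ p] (by the supremum of
    [`|f|] when [p = +oo]), which is subadditive up to a constant for every
    [p > 0]. On a small cube, differences of order [r] are bounded in
    every direction, since translations are continuous in measure and [E] is
    dense up to sign; hence so are mixed differences of order [r], by
    polarization. If all first differences of [F] are bounded on a cube then [F]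
    is close to a constant, by Fubini. So a mixed difference of order [r - 1] is
    close to a constant, and this constant is an almost additive bounded
    function of each step, hence is determined up to a constant by its values on
    a basis. Subtracting a combination of Newton polynomials with the same
    values lowers the order of the bounded differences by one, and by induction
    [f] is close to a polynomial [Q] of degree less than [r] on the cube. Finally
    [f x - Q x] is controlled by the [f (x + j h) - Q (x + j h)] for [0 < j <= r],
    with [h] in a direction of [E] almost pointing to the centre of the cube; this
    spreads the bound along segments, and compactness of the body finishes. *)

(** * Lebesgue measure on row vectors *)

Lemma lebesgue_measure_shift (R : realType) (a : R) (A : set R) :
  measurable A ->
  lebesgue_measure ((fun x => x + a) @^-1` A) = lebesgue_measure A.
Proof.
move=> mA.
have ma : measurable_fun [set: measurableTypeR R]
    ((fun x => x + a) : _ -> measurableTypeR R) by exact: measurable_funD.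
pose m : {measure set (measurableTypeR R) -> \bar R} :=
  measure_function_pushforward__canonical__measure_function_Measure
  (@lebesgue_measure R) ma.
rewrite -[LHS]/(m A); apply/esym.
suff mE X : ocitv X -> lebesgue_measure X = m X.
  exact: (@lebesgue_measure_unique R m mE A mA).
move=> [[x y] _ <-] /=.
rewrite /pushforward.
rewrite (_ : _ @^-1` _ = [set` `]x - a, y - a]]); last first.
  apply/seteqP; split => z /=; rewrite !in_itv/= ltrBlDr lerBrDr//.
rewrite !lebesgue_measure_itv/= !lte_fin ltrD2r.
by case: ifP => // _; rewrite -!EFinB; congr EFin; ring.
Qed.

Lemma measurable_rVD (R : realType) n :
  measurable_fun [set: 'rV[R]_n * 'rV[R]_n] (fun z => z.1 + z.2).
Proof.
apply: measurable_fun_rV => i.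
rewrite (_ : _ \o _ = (rV_coor i \o fst) \+ (rV_coor i \o snd)); last first.
  by apply/funext => z /=; rewrite /rV_coor mxE.
by apply: measurable_funD; apply: measurableT_comp => //; exact: measurable_rV_coor.
Qed.

Lemma measurable_rV_shift (R : realType) n (h : 'rV[R]_n) :
  measurable_fun [set: 'rV[R]_n] (fun x => x + h).
Proof.
apply: measurable_fun_rV => i.
rewrite (_ : _ \o _ = rV_coor i \+ cst (h ord0 i)); last first.
  by apply/funext => x /=; rewrite /rV_coor mxE.
by apply: measurable_funD => //; exact: measurable_rV_coor.
Qed.

Lemma measurable_preimage_shift (R : realType) n (h : 'rV[R]_n) (A : set 'rV[R]_n) :
  measurable A -> measurable ((fun x => x + h) @^-1` A).
Proof.
by move=> mA; rewrite -[X in measurable X]setTI; exact: measurable_rV_shift.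
Qed.

Lemma lebesgue_rV_shift (R : realType) n (h : 'rV[R]_n) (A : set 'rV[R]_n) :
  measurable A ->
  lebesgue_rV R n ((fun x => x + h) @^-1` A) = lebesgue_rV R n A.
Proof.
elim: n h A => [|n IH] h A mA.
  rewrite (_ : _ @^-1` _ = A)//; apply/funext => x.
  by rewrite /preimage /= (_ : x + h = x)//; apply/rowP; case.
rewrite /= /lebesgue_cons /pushforward.
set mu := (@lebesgue_measure R \x lebesgue_rV R n)%E.
pose g (z : measurableTypeR R * 'rV[R]_n) : measurableTypeR R * 'rV[R]_n :=
  ((z.1 : R) + (uncons_rV h).1, z.2 + (uncons_rV h).2).
have mg : measurable_fun [set: measurableTypeR R * 'rV[R]_n] g.
  apply/measurable_fun_pairP; split.
    by apply: measurable_funD => //.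
  exact: (measurableT_comp (measurable_rV_shift (uncons_rV h).2) measurable_snd).
pose m : {measure set (measurableTypeR R * 'rV[R]_n) -> \bar R} :=
  measure_function_pushforward__canonical__measure_function_Measure mu mg.
rewrite (_ : _ @^-1` _ = g @^-1` (@cons_rV R n @^-1` A)); last first.
  apply/funext => z; rewrite /preimage /= /g; congr (A _).
  apply/rowP => i; rewrite mxE.
  have [k|k] := split_ordP (i : 'I_(1 + n)) => -> /=.
    have -> : lshift n k = ord0 by apply/val_inj; rewrite /= ord1.
    by rewrite !cons_rV0.
  by rewrite !cons_rVS !mxE.
rewrite -[LHS]/(m (@cons_rV R n @^-1` A)); apply/esym.
have mX : measurable (@cons_rV R n @^-1` A).
  by rewrite -[X in measurable X]setTI; apply: measurable_cons_rV.
suff mE : forall B C, measurable B -> measurable C ->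
    m (B `*` C) = (@lebesgue_measure R B * lebesgue_rV R n C)%E.
  exact: (product_measure_unique mE mX).
move=> B C mB mC.
rewrite [LHS](_ : _ = mu (((fun x => x + (uncons_rV h).1) @^-1` B) `*`
     ((fun x => x + (uncons_rV h).2) @^-1` C)))//.
rewrite /mu product_measure1E//.
- by congr (_ * _)%E; [exact: lebesgue_measure_shift|exact: IH].
- rewrite -[X in measurable X]setTI.
    have ma : measurable_fun [set: measurableTypeR R] (fun x : R => x + (uncons_rV h).1).
      exact: measurable_funD.
    exact: ma.
- exact: measurable_preimage_shift.
Qed.

Lemma integral_rV_shift (R : realType) n (h : 'rV[R]_n) (A : set 'rV[R]_n)
    (f : 'rV[R]_n -> \bar R) :
  measurable A -> measurable_fun A f -> (forall x, 0 <= f x)%E ->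
  (\int[lebesgue_rV R n]_(x in (fun x => (x + h)%R) @^-1` A) f (x + h)%R =
   \int[lebesgue_rV R n]_(x in A) f x)%E.
Proof.
move=> mA mf f0.
rewrite -(ge0_integral_pushforward (measurable_rV_shift h) _ mA mf); last first.
  by move=> x _; exact: f0.
apply: eq_measure_integral => [|H B mB _]; first exact: measurable_rV_shift.
exact: lebesgue_rV_shift.
Qed.

Lemma rV_norm_le (R : realType) n (x : 'rV[R]_n) (s : R) : 0 <= s ->
  `|x| <= s <-> forall i, `|x ord0 i| <= s.
Proof.
move=> s0; rewrite [`|x|]/Num.Def.normr/= mx_normrE; split => [H i|H].
  apply: le_trans H; apply: (@bigmax_sup _ _ _ _ (ord0, i)) => //=.
by apply/bigmax_leP; split => // -[i j] _ /=; rewrite ord1.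
Qed.

Definition cube (R : realType) n (c : 'rV[R]_n) (s : R) : set 'rV[R]_n :=
  [set x | `|x - c| <= s].

Lemma cubeE (R : realType) n (c : 'rV[R]_n) (s : R) : 0 <= s ->
  cube c s = [set x | forall i, [set` `[c ord0 i - s, c ord0 i + s]] (x ord0 i)].
Proof.
move=> s0; apply/seteqP; split => x /=.
  move=> /(rV_norm_le _ s0) H i; have := H i.
  by rewrite !mxE in_itv/= ler_distl.
move=> H; apply/(rV_norm_le _ s0) => i; have := H i.
by rewrite !mxE in_itv/= ler_distl.
Qed.

Lemma cube_closed (R : realType) n (c : 'rV[R]_n) (s : R) : closed (cube c s).
Proof.
apply: (@closed_comp _ _ (fun x : 'rV[R]_n => `|x - c|) [set x | x <= s]); last first.
  exact: closed_le.
move=> x _; apply: (@cvg_norm R 'rV[R]_n 'rV[R]_n (nbhs x)).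
by apply: (@cvgB R 'rV[R]_n 'rV[R]_n (nbhs x)); [exact: cvg_id|exact: cvg_cst].
Qed.

Lemma measurable_closed (R : realType) n (A : set 'rV[R]_n) :
  closed A -> measurable A.
Proof.
move=> cA; have oA : open (~` A) by rewrite openC.
by rewrite -(setCK A); exact: (measurableC (open_measurable_rV oA)).
Qed.

Lemma measurable_cube (R : realType) n (c : 'rV[R]_n) s : measurable (cube c s).
Proof. exact: (measurable_closed (@cube_closed _ _ _ _)). Qed.

Lemma lebesgue_cube (R : realType) n (c : 'rV[R]_n) (s : R) : 0 <= s ->
  lebesgue_rV R n (cube c s) = ((2 * s) ^+ n)%:E.
Proof.
move=> s0; rewrite cubeE//.
rewrite (lebesgue_rV_box (A := fun i => [set` `[c ord0 i - s, c ord0 i + s]]))//.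
under eq_bigr => i _.
  rewrite (_ : lebesgue_measure _ = (2 * s)%:E); last first.
    rewrite lebesgue_measure_itv/= lte_fin.
    case: ifPn => [_|]; first by rewrite -EFinB; congr EFin; ring.
    by rewrite -leNgt => H; congr EFin; lra.
  over.
by rewrite prodEFin prodr_const card_ord.
Qed.

(** * The gauge of a function *)

Section gauge.
Context {R : realType} {d : nat}.
Local Notation V := 'rV[R]_d.
Local Notation mu := (lebesgue_rV R d).
Implicit Types (S T : set V) (F G : V -> R) (p : \bar R).

(* [Lp_norm] without the final root; the value at [-oo] is irrelevant. *)
Definition gauge p S F : \bar R :=
  match p with
  | q%:E => (\int[mu]_(x in S) (`|F x| `^ q)%:E)%E
  | _ => ereal_sup ([set 0%E] `|` [set `|F x|%:E | x in S])
  end.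

Definition adm p F : Prop :=
  match p with _%:E => measurable_fun setT F | _ => True end.

Lemma measurable_powR_norm S F (q : R) : measurable_fun setT F ->
  measurable S -> measurable_fun S (fun x => (`|F x| `^ q)%:E).
Proof.
move=> mF mS; apply: (measurable_funS measurableT) => //.
apply/measurable_EFinP; apply: (measurableT_comp (measurable_powR q)).
exact: measurableT_comp.
Qed.
Arguments measurable_powR_norm [S F] q.

Lemma admD p F G : adm p F -> adm p G -> adm p (F \+ G).
Proof. by case: p => //= q; exact: measurable_funD. Qed.

Lemma admZ p (a : R) F : adm p F -> adm p (a \*o F).
Proof. by case: p => //= q mF; exact: measurable_funM. Qed.

Lemma admB p F G : adm p F -> adm p G -> adm p (F \- G).
Proof. by case: p => //= q; exact: measurable_funB. Qed.

Lemma adm_cst p (c : R) : adm p (cst c).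
Proof. by case: p => //= q; exact: measurable_cst. Qed.

Lemma adm_shift p (h : V) F : adm p F -> adm p (fun x => F (x + h)).
Proof.
by case: p => //= q mF; exact: (measurableT_comp mF (measurable_rV_shift h)).
Qed.

Lemma adm_sum p (I : Type) (r : seq I) (P : pred I) (F : I -> V -> R) :
  (forall i, adm p (F i)) -> adm p (fun x => \sum_(i <- r | P i) F i x).
Proof.
case: p => //= q mF; elim: r => [|i r IH].
  by under eq_fun do rewrite big_nil; exact: measurable_cst.
under eq_fun do rewrite big_cons; case: (P i) => //.
exact: measurable_funD.
Qed.

Lemma gauge_ge0 p S F : (0 <= gauge p S F)%E.
Proof.
case: p => [q| |] /=; [|by apply: ereal_sup_ubound; left..].
by apply: integral_ge0 => x _; rewrite lee_fin powR_ge0.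
Qed.

Lemma gauge_oo_le S F (C : R) : 0 <= C ->
  (gauge +oo S F <= C%:E)%E <-> (forall x, S x -> `|F x| <= C).
Proof.
move=> C0; split => [H x Sx|H] /=.
  rewrite -lee_fin; apply: le_trans H; apply: ereal_sup_ubound.
  by right; exists x.
apply: ge_ereal_sup => _ [->|[x Sx <-]]; rewrite lee_fin//; exact: H.
Qed.

Lemma gauge_eq p S F G : {in S, F =1 G} -> gauge p S F = gauge p S G.
Proof.
move=> FG; case: p => [q| |] /=; first by apply: eq_integral => x xS; rewrite FG.
all: congr (ereal_sup (_ `|` _)); apply/seteqP.
all: by split=> _ [x Sx <-]; exists x; rewrite // FG// inE.
Qed.

Lemma gauge_subset p S T F : measurable S -> measurable T -> adm p F ->
  S `<=` T -> (gauge p S F <= gauge p T F)%E.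
Proof.
case: p => [q| |]//= mS mT mF ST.
2,3: by apply: ereal_sup_le; apply: setUS; exact: image_subset.
by apply: ge0_subset_integral => //; exact: measurable_powR_norm.
Qed.

Lemma gauge_setU p S T F : measurable S -> measurable T -> adm p F ->
  (gauge p (S `|` T) F <= gauge p S F + gauge p T F)%E.
Proof.
case: p => [q| |] mS mT mF; last 2 first.
1,2: apply: ge_ereal_sup => _ [->|[x STx <-]];
  first by apply: adde_ge0; exact: gauge_ge0.
1,2: by case: STx => [Sx|Tx];
  [apply: le_trans (leeDl _ (gauge_ge0 _ _ _))|apply: le_trans (leeDr _ (gauge_ge0 _ _ _))];
  apply: ereal_sup_ubound; right; exists x.
have -> : S `|` T = S `|` (T `\` S).
  apply/seteqP; split => x [Sx|]; [by left| |by left|by case; right].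
  by move=> Tx; have [Sx|Sx] := pselect (S x); [left|right].
rewrite /= ge0_integral_setU//.
- by apply: leeD2l; apply: (@gauge_subset q%:E) => //; exact: measurableD.
- exact: measurableD.
- by apply: measurable_powR_norm => //; apply: measurableU => //; exact: measurableD.
- by apply/disj_setPS => x [Sx [_]].
Qed.

Lemma gauge_shift p S F (h : V) : measurable S -> adm p F ->
  gauge p ((fun x => x + h) @^-1` S) (fun x => F (x + h)) = gauge p S F.
Proof.
case: p => [q| |]/= mS mF.
  apply: (integral_rV_shift h mS (f := fun x => (`|F x| `^ q)%:E)).
    exact: measurable_powR_norm.
  by move=> x; rewrite lee_fin powR_ge0.
all: congr (ereal_sup (_ `|` _)); apply/seteqP; split => _ [x Sx <-].
all: by [exists (x + h)|exists (x - h); rewrite /= ?subrK].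
Qed.

Lemma gaugeD p (C1 C2 : R) : (0 < p)%E -> exists K, forall S F G,
  measurable S -> adm p F -> adm p G ->
  (gauge p S F <= C1%:E)%E -> (gauge p S G <= C2%:E)%E ->
  (gauge p S (F \+ G)%R <= K%:E)%E.
Proof.
case: p => [q| |]// q0.
  have {}q0 : 0 < q by rewrite -lte_fin.
  exists (2 `^ q * (C1 + C2)) => S F G mS mF mG; rewrite /gauge => FC GC.
  apply: (@le_trans _ _ (\int[mu]_(x in S)
     ((2 `^ q)%:E * ((`|F x| `^ q)%:E + (`|G x| `^ q)%:E)))%E).
    apply: ge0_le_integral => //.
    - by apply: (measurable_powR_norm q (F := F \+ G)) => //; exact: (@admD q%:E).
    - apply: measurable_funeM; apply: emeasurable_funD; exact: measurable_powR_norm.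
    - move=> x Sx; rewrite -EFinD -EFinM lee_fin.
      wlog FG : F G {mF mG FC GC} / `|F x| <= `|G x|.
        move=> H; have [FG|/ltW GF] := leP `|F x| `|G x|; first exact: H.
        by rewrite /= (addrC (F x)) (addrC (`|F x| `^ q)); exact: H.
      apply: (@le_trans _ _ ((2 * `|G x|) `^ q)).
        apply: ge0_ler_powR; rewrite ?nnegrE ?mulr_ge0//; first exact: ltW.
        by apply: le_trans (ler_normD (F x) (G x)) _; lra.
      by rewrite powRM// ler_pM2l ?powR_gt0// lerDr powR_ge0.
  rewrite ge0_integralZl//; last 2 first.
  - by apply: emeasurable_funD; exact: measurable_powR_norm.
  - by move=> x _; rewrite adde_ge0.
  rewrite EFinM; apply: lee_wpmul2l; first by rewrite lee_fin powR_ge0.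
  rewrite ge0_integralD//; first by rewrite EFinD; exact: leeD.
  - exact: measurable_powR_norm.
  - exact: measurable_powR_norm.
exists (C1 + C2) => S F G mS _ _ FC GC.
have C10 : 0 <= C1 by rewrite -lee_fin; exact: le_trans (gauge_ge0 +oo S F) FC.
have C20 : 0 <= C2 by rewrite -lee_fin; exact: le_trans (gauge_ge0 +oo S G) GC.
apply/(@gauge_oo_le S); first exact: addr_ge0.
move=> x Sx; apply: le_trans (ler_normD (F x) (G x)) _.
apply: lerD.
  by move/(@gauge_oo_le S) : FC; exact.
by move/(@gauge_oo_le S) : GC; exact.
Qed.

Lemma gaugeZ p (a : R) S F : (0 < p)%E -> measurable S -> adm p F ->
  gauge p S (a \*o F) =
  ((if p is q%:E then `|a| `^ q else `|a|)%:E * gauge p S F)%E.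
Proof.
case: p => [q| |]// q0 mS mF; rewrite /gauge.
  under eq_integral => x _ do rewrite normrM powRM// EFinM.
  rewrite ge0_integralZl// ?lee_fin ?powR_ge0//; exact: measurable_powR_norm.
apply/eqP; rewrite eq_le; apply/andP; split.
  apply: ge_ereal_sup => _ [->|[x Sx <-]].
    by rewrite mule_ge0// (gauge_ge0 +oo).
  rewrite normrM EFinM lee_wpmul2l//; apply: ereal_sup_ubound; right; by exists x.
have [->|a0] := eqVneq a 0.
  by rewrite normr0 mul0e; apply: ereal_sup_ubound; left.
rewrite -lee_pdivlMl ?normr_gt0//; apply: ge_ereal_sup => _ [->|[x Sx <-]].
  by rewrite mule_ge0 ?lee_fin ?invr_ge0//; apply: ereal_sup_ubound; left.
rewrite lee_pdivlMl ?normr_gt0// -EFinM -normrM.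
by apply: ereal_sup_ubound; right; exists x.
Qed.

Lemma gaugeZ_le p (a C : R) : (0 < p)%E -> exists K, forall S F,
  measurable S -> adm p F -> (gauge p S F <= C%:E)%E ->
  (gauge p S (a \*o F)%R <= K%:E)%E.
Proof.
move=> p0; exists ((if p is q%:E then `|a| `^ q else `|a|) * C) => S F mS mF FC.
rewrite gaugeZ// EFinM lee_wpmul2l// lee_fin.
by case: (p) => [q| |]//; rewrite powR_ge0.
Qed.

Lemma gaugeB p (C1 C2 : R) : (0 < p)%E -> exists K, forall S F G,
  measurable S -> adm p F -> adm p G ->
  (gauge p S F <= C1%:E)%E -> (gauge p S G <= C2%:E)%E ->
  (gauge p S (F \- G)%R <= K%:E)%E.
Proof.
move=> p0; have [K2 HK2] := gaugeZ_le (-1) C2 p0.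
have [K HK] := gaugeD C1 K2 p0; exists K => S F G mS mF mG FC GC.
rewrite (_ : F \- G = F \+ (-1) \*o G); last first.
  by apply/funext => x /=; rewrite mulN1r.
by apply: HK => //; [exact: admZ|exact: HK2].
Qed.

Lemma gauge_sum p (I : Type) (r : seq I) (C : I -> R) : (0 < p)%E ->
  exists K, forall S (F : I -> V -> R),
  measurable S -> (forall i, adm p (F i)) ->
  (forall i, gauge p S (F i) <= (C i)%:E)%E ->
  (gauge p S (fun x => (\sum_(i <- r) F i x)%R) <= K%:E)%E.
Proof.
move=> p0; elim: r => [|i r [K HK]].
  exists 0 => S F mS mF FC.
  under eq_fun do rewrite big_nil.
  rewrite -[X in gauge _ _ X]/(cst 0) (_ : cst 0 = (0 : R) \*o (cst 0 : V -> R)).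
    rewrite gaugeZ//; last exact: adm_cst.
    case: p p0 {mF FC} => [q| |]//= q0.
      by rewrite normr0 powR0 ?mul0e// gt_eqF// -lte_fin.
    by rewrite normr0 mul0e.
  by apply/funext => x; rewrite /= mul0r.
have [K' HK'] := gaugeD (C i) K p0; exists K' => S F mS mF FC.
under eq_fun do rewrite big_cons.
apply: (HK' S (F i)) => //; first exact: adm_sum.
exact: HK.
Qed.

Lemma gauge_bounded p S (M : R) : (0 < p)%E -> measurable S ->
  (mu S < +oo)%E -> 0 <= M -> exists K, forall F, adm p F ->
  (forall x, S x -> `|F x| <= M) -> (gauge p S F <= K%:E)%E.
Proof.
case: p => [q| |]//= q0 mS Soo M0; last first.
  by exists M => F _ FM; apply/(@gauge_oo_le S).
have {}q0 : 0 < q by rewrite -lte_fin.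
exists (M `^ q * fine (mu S)) => F mF FM.
apply: (@le_trans _ _ (\int[mu]_(x in S) cst (M `^ q)%:E x)%E).
  apply: ge0_le_integral => //.
  - exact: measurable_powR_norm.
  - move=> x Sx; rewrite lee_fin ge0_ler_powR ?nnegrE ?FM// ltW//.
rewrite integral_cst// EFinM fineK// ge0_fin_numE//.
Qed.

Lemma lebesgue_cube_lty (c : V) (s : R) : 0 < s -> (mu (cube c s) < +oo)%E.
Proof. by move=> s0; rewrite lebesgue_cube ?ltW// ltry. Qed.

Lemma gauge_cst_inv p (z : V) (s C : R) : (0 < p)%E -> 0 < s ->
  exists K, forall c : R, (gauge p (cube z s) (cst c) <= C%:E)%E -> `|c| <= K.
Proof.
case: p => [q| |]//= q0 s0; last first.
  exists C => c cC; rewrite -lee_fin; apply: le_trans cC.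
  by apply: ereal_sup_ubound; right; exists z => //; rewrite /cube /= subrr normr0 ltW.
have {}q0 : 0 < q by rewrite -lte_fin.
set m := (2 * s) ^+ d; have m0 : 0 < m by rewrite exprn_gt0// mulr_gt0.
exists ((C / m) `^ q^-1) => c.
rewrite (integral_cst mu (measurable_cube z s) (`|c| `^ q)%:E).
rewrite [X in (_ * X)%E](lebesgue_cube z (ltW s0)) -EFinM lee_fin -ler_pdivlMr// => H.
rewrite -[leLHS]powRr1// -(mulfV (lt0r_neq0 q0)) powRrM ge0_ler_powR ?nnegrE//.
- by rewrite invr_ge0 ltW.
- by apply: le_trans H; exact: powR_ge0.
Qed.
End gauge.

Lemma gauge_near_cst (R : realType) (d : nat) (p : \bar R) (z : 'rV[R]_d)
    (s C : R) : (0 < p)%E -> 0 < s -> exists K, forall F, adm p F ->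
  (forall k, `|k| <= 2 * s ->
    (gauge p (cube z s) (fun x => F (x + k) - F x)%R <= C%:E)%E) ->
  exists c, (gauge p (cube z s) (fun x => F x - c)%R <= K%:E)%E.
Proof.
case: p => [q| |]// q0 s0; last first.
  exists C => F _ FC; exists (F z).
  have C0 : 0 <= C.
    rewrite -lee_fin; apply: le_trans (gauge_ge0 _ _ _) (FC 0 _).
    by rewrite normr0 mulr_ge0// ltW.
  apply/gauge_oo_le => // x zx.
  have zxs : `|x - z| <= 2 * s by apply: le_trans zx _; lra.
  have /gauge_oo_le := FC _ zxs; move=> /(_ C0 z).
  rewrite subrKC; apply.
  by rewrite /cube /= subrr normr0 ltW.
set S := cube z s; set T := cube (0 : 'rV[R]_d) (2 * s).
have mS : measurable S by exact: measurable_cube.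
have mT : measurable T by exact: measurable_cube.
set mu := lebesgue_rV R d.
set a := (2 * s) ^+ d; set b := (2 * (2 * s)) ^+ d.
have a0 : 0 < a by rewrite exprn_gt0// mulr_gt0.
have muS : mu S = a%:E by exact/lebesgue_cube/ltW.
have muT : mu T = b%:E by apply: lebesgue_cube; rewrite mulr_ge0// ltW.
exists ((C * b + 1) / a) => F mF FC.
pose f (w : 'rV[R]_d * 'rV[R]_d) : \bar R :=
  (`|F (w.2 + w.1) - F w.2| `^ q)%:E.
pose g := f \_ (T `*` S).
have mf : measurable_fun setT f.
  apply/measurable_EFinP; apply: (measurableT_comp (measurable_powR q)).
  apply: measurableT_comp => //; apply: measurable_funB.
    apply: (measurableT_comp mF).
    rewrite (_ : (fun _ => _) = (fun w : 'rV[R]_d * 'rV[R]_d => w.1 + w.2)).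
      exact: measurable_rVD.
    by apply/funext => w; rewrite addrC.
  exact: measurableT_comp.
have mg : measurable_fun setT g.
  apply/(measurable_restrictT _ _).1; first exact: measurableX.
  exact: measurable_funS mf.
have f0 w : (0 <= f w)%E by rewrite lee_fin powR_ge0.
have g0 w : (0 <= g w)%E by rewrite /g /patch; case: ifP.
have gE k x : g (k, x) = if k \in T then ((fun x => f (k, x)) \_ S) x else 0%E.
  rewrite /g /patch in_setX /=.
  by case: (k \in T) => //=.
have gE' k x : g (k, x) = if x \in S then ((fun k => f (k, x)) \_ T) k else 0%E.
  rewrite gE /patch.
  by case: (k \in T) => //=; case: ifP.
have le1 : (\int[mu]_k \int[mu]_x g (k, x) <= (C * b)%:E)%E.
  apply: (@le_trans _ _ (\int[mu]_(k in T) cst C%:E k)%E).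
    rewrite [leRHS]integral_mkcond; apply: ge0_le_integral => //.
    - by move=> k _; exact: integral_ge0.
    - exact: (measurable_fun_fubini_tonelli_F (m2 := mu)).
    - by apply/(measurable_restrictT _ _).1 => //; exact: measurable_cst.
    - move=> k _; rewrite /patch; case: ifPn => kT.
        under eq_integral do rewrite gE kT.
        rewrite -integral_mkcond; apply: FC.
        by move: kT; rewrite inE /T /cube /= subr0.
      under eq_integral do rewrite gE (negbTE kT).
      by rewrite integral0.
  by rewrite (integral_cst mu mT) [X in (_ * X <= _)%E]muT EFinM.
have le2 : (\int[mu]_x fubini_G mu g x <= (C * b)%:E)%E.
  by apply: le_trans le1; rewrite (fubini_tonelli (m1 := mu) (m2 := mu) g mg g0).
have GE x : S x -> fubini_G mu g x = (\int[mu]_(k in T) f (k, x))%E.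
  move=> Sx; rewrite [RHS]integral_mkcond; apply: eq_integral => k _.
  by rewrite gE' mem_set.
have [x Sx fx] : exists2 x, S x &
    (\int[mu]_(k in T) f (k, x) <= ((C * b + 1) / a)%:E)%E.
  apply: contrapT => H.
  have C0 : 0 <= C.
    rewrite -lee_fin; apply: le_trans (gauge_ge0 q%:E S _) (FC 0 _).
    by rewrite normr0 mulr_ge0// ltW.
  have c0 : 0 <= (C * b + 1) / a.
    rewrite divr_ge0//; last exact: ltW.
    by rewrite addr_ge0// mulr_ge0// exprn_ge0// !mulr_ge0// ltW.
  have : (\int[mu]_(x in S) cst ((C * b + 1) / a)%:E x <=
      \int[mu]_x fubini_G mu g x)%E.
    rewrite integral_mkcond; apply: ge0_le_integral => //.
    - by move=> x _; rewrite /patch; case: ifP => //; rewrite lee_fin.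
    - by apply/(measurable_restrictT _ _).1 => //; exact: measurable_cst.
    - exact: (measurable_fun_fubini_tonelli_G (m1 := mu)).
    - move=> x _; rewrite /patch; case: ifPn => [|_].
        rewrite inE => Sx; rewrite GE// leNgt; apply/negP => /ltW fx; apply: H.
        by exists x.
      exact: integral_ge0.
  rewrite (integral_cst mu mS) [X in (_ * X <= _)%E]muS => /le_trans/(_ le2).
  by rewrite -EFinM lee_fin mulfVK ?gt_eqF//; lra.
exists (F x).
apply: le_trans fx.
pose B := (fun k => k + x) @^-1` S.
have mB : measurable B.
  exact: measurable_preimage_shift.
have mfx : measurable_fun setT (fun k => f (k, x)).
  apply: (measurable_powR_norm (F := fun k => F (x + k) - F x)) => //.
  apply: measurable_funB => //.
  by under eq_fun do rewrite addrC; exact: (@adm_shift _ _ q%:E).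
have -> : gauge q%:E S (fun y => F y - F x) = (\int[mu]_(k in B) f (k, x))%E.
  apply: etrans (esym (integral_rV_shift x mS
    (f := fun y => (`|F y - F x| `^ q)%:E) _ _)) _ => //.
    apply: (measurable_powR_norm (F := fun y => F y - F x)) => //.
    exact: measurable_funB.
  by apply: eq_integral => k _; rewrite /f /= (addrC k x).
apply: ge0_subset_integral => //.
  exact: measurable_funS mfx.
move=> k; rewrite /B /S /T /cube /= subr0 => kx.
have -> : k = (k + x - z) - (x - z) by rewrite opprB addrA subrK addrK.
by apply: le_trans (ler_normB _ _) _; have := Sx; rewrite /S /cube /= => ?; lra.
Qed.

(** * Mixed differences and polynomials *)

Section mixed_differences.
Context {R : realType} {d : nat}.
Local Notation V := 'rV[R]_d.
Implicit Types (h k x : V) (hs ks : seq V) (f g Q : V -> R).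

Definition mdiff hs f : V -> R := foldr (fun h g x => g (x + h) - g x) f hs.

Lemma mdiff_cat hs ks f : mdiff (hs ++ ks) f = mdiff hs (mdiff ks f).
Proof. by rewrite /mdiff foldr_cat. Qed.

Lemma mdiff_diff hs h f :
  mdiff hs (fun x => f (x + h) - f x) =
  (fun x => mdiff hs f (x + h) - mdiff hs f x).
Proof.
elim: hs => //= k hs ->; apply/funext => x.
by rewrite (addrAC x h k); ring.
Qed.

Lemma mdiffC hs ks f : mdiff hs (mdiff ks f) = mdiff ks (mdiff hs f).
Proof. by elim: hs => //= h hs ->; rewrite mdiff_diff. Qed.

Lemma mdiff_perm hs ks f : perm_eq hs ks -> mdiff hs f = mdiff ks f.
Proof.
apply: (catCA_perm_subst (F := mdiff ^~ f)) => s1 s2 s3.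
by rewrite !mdiff_cat mdiffC.
Qed.

Lemma mdiffZ hs (a : R) f : mdiff hs (a \*o f) = a \*o mdiff hs f.
Proof. by elim: hs => //= h hs ->; apply/funext => x /=; ring. Qed.

Lemma mdiffB hs f g : mdiff hs (f \- g) = mdiff hs f \- mdiff hs g.
Proof.
by elim: hs => //= h hs ->; apply/funext => x /=; ring.
Qed.

Lemma mdiff_cst0 hs : mdiff hs (cst 0) = cst 0.
Proof. by elim: hs => //= h hs ->; apply/funext => x /=; rewrite subrr. Qed.

Lemma mdiff_sum hs (I : Type) (r : seq I) (P : pred I) (F : I -> V -> R) :
  mdiff hs (fun x => \sum_(i <- r | P i) F i x) =
  (fun x => \sum_(i <- r | P i) mdiff hs (F i) x).
Proof.
elim: hs => //= h hs ->; apply/funext => x.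
by rewrite -sumrB.
Qed.

Lemma mdiff0 hs f : 0 \in hs -> mdiff hs f = cst 0.
Proof.
move=> h0; rewrite (mdiff_perm _ (perm_to_rem h0)) /=.
by apply/funext => x; rewrite addr0 subrr.
Qed.

Lemma finite_diffS r h f x :
  finite_diff r.+1 h f x = finite_diff r h f (x + h) - finite_diff r h f x.
Proof.
rewrite /finite_diff.
have -> : \sum_(j < r.+1) (-1) ^+ (r + j) * 'C(r, j)%:R * f (x + h *+ j) =
    \sum_(j < r.+2) (-1) ^+ (r + j) * 'C(r, j)%:R * f (x + h *+ j).
  by rewrite [RHS]big_ord_recr /= bin_small// mulr0 mul0r addr0.
rewrite big_ord_recl [X in _ - X]big_ord_recl opprD addrCA -sumrB.
congr (_ + _); first by rewrite /= !bin0 !addn0 exprS; ring.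
apply: eq_bigr => i _.
rewrite lift0 binS natrD addSn !addnS !exprS mulrS addrA; ring.
Qed.

Lemma finite_diffE r h f : finite_diff r h f = mdiff (nseq r h) f.
Proof.
elim: r => [|r IH] /=; apply/funext => x.
  by rewrite /finite_diff big_ord1 expr0 bin0 mulr0n addr0 !mul1r.
by rewrite finite_diffS IH.
Qed.

Inductive polydeg : nat -> (V -> R) -> Prop :=
| polydeg_cst n (c : R) : polydeg n (fun=> c)
| polydeg_mul n (i : 'I_d) (a c : R) Q : polydeg n Q ->
    polydeg n.+1 (fun x => (a * x ord0 i + c) * Q x)
| polydegZ n (a : R) Q : polydeg n Q -> polydeg n (fun x => a * Q x)
| polydegD n Q1 Q2 : polydeg n Q1 -> polydeg n Q2 ->
    polydeg n (fun x => Q1 x + Q2 x).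

Lemma polydegS n Q : polydeg n Q -> polydeg n.+1 Q.
Proof. by elim=> *; constructor. Qed.

Lemma polydegW n m Q : (n <= m)%N -> polydeg n Q -> polydeg m Q.
Proof. by move=> /subnK <- nQ; elim: (_ - _)%N => // k; exact: polydegS. Qed.

Lemma polydeg_shift n Q h : polydeg n Q -> polydeg n (fun x => Q (x + h)).
Proof.
elim=> [m c|m i a c P _ IH|m a P _ IH|m P1 P2 _ IH1 _ IH2]; try by constructor.
under eq_fun do rewrite mxE mulrDr -addrA.
exact: polydeg_mul.
Qed.

Lemma polydeg0_cst Q : polydeg 0 Q -> exists c, Q = cst c.
Proof.
suff H n P : polydeg n P -> n = 0%N -> exists c, P = cst c by move=> /H; exact.
elim=> {n P} [m c|//|m a P _ IH|m P1 P2 _ IH1 _ IH2] m0.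
- by exists c.
- by have [c ->] := IH m0; exists (a * c).
- by have [c1 ->] := IH1 m0; have [c2 ->] := IH2 m0; exists (c1 + c2).
Qed.

Lemma polydeg_diff n Q h : polydeg n Q -> polydeg n.-1 (fun x => Q (x + h) - Q x).
Proof.
elim=> [m c|m i a c P mP IH|m a P _ IH|m P1 P2 _ IH1 _ IH2] /=.
- under eq_fun do rewrite subrr; exact: polydeg_cst.
- rewrite (_ : (fun _ => _) = (fun x => (a * x ord0 i + c) * (P (x + h) - P x) +
      (a * h ord0 i) * P (x + h))); last first.
    by apply/funext => x; rewrite mxE; ring.
  apply: polydegD; last exact/polydegZ/polydeg_shift.
  case: m mP IH => [|m] mP IH /=; last exact: polydeg_mul.
  have [b ->] := polydeg0_cst mP.
  by under eq_fun do rewrite /= subrr mulr0; exact: polydeg_cst.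
- by under eq_fun do rewrite -mulrBr; exact: polydegZ.
- by under eq_fun do rewrite opprD addrACA; exact: polydegD.
Qed.

Lemma mdiff_polydeg n Q hs : polydeg n Q -> size hs = n -> exists c, mdiff hs Q = cst c.
Proof.
elim: hs n Q => [|h hs IH] n Q nQ /=.
  by move=> n0; move: nQ; rewrite -n0; exact: polydeg0_cst.
move=> nE; rewrite -mdiff_diff; apply: (IH n.-1); first exact: polydeg_diff.
by rewrite -nE.
Qed.

Lemma mdiff_polydeg0 n Q hs : polydeg n Q -> (n < size hs)%N -> mdiff hs Q = cst 0.
Proof.
case: hs => // h hs nQ /=; rewrite ltnS => nh.
have [c /= ->] := mdiff_polydeg (polydegW nh nQ) erefl.
by apply/funext => x; rewrite subrr.
Qed.

Lemma polydeg_continuous n Q : polydeg n Q -> continuous Q.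
Proof.
elim=> [m c|m i a c P _ IH|m a P _ IH|m P1 P2 _ IH1 _ IH2] x.
- exact: cst_continuous.
- apply: (@cvgM _ _ (nbhs x)); last exact: IH.
  apply: (@cvgD _ _ _ (nbhs x)); last exact: cvg_cst.
  apply: (@cvgM _ _ (nbhs x)); first exact: cvg_cst.
  exact: coord_continuous.
- by apply: (@cvgM _ _ (nbhs x)); [exact: cvg_cst|exact: IH].
- by apply: (@cvgD _ _ _ (nbhs x)); [exact: IH1|exact: IH2].
Qed.

Lemma polydeg_measurable n Q : polydeg n Q -> measurable_fun setT Q.
Proof.
elim=> [m c|m i a c P _ IH|m a P _ IH|m P1 P2 _ IH1 _ IH2].
- exact: measurable_cst.
- apply: measurable_funM => //; apply: measurable_funD => //.
  by apply: measurable_funM => //; exact: measurable_rV_coor.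
- exact: measurable_funM.
- exact: measurable_funD.
Qed.

Lemma polydeg_bounded n Q (s : R) : polydeg n Q ->
  exists M, forall x, `|x| <= s -> `|Q x| <= M.
Proof.
move=> nQ; have [s0|s0] := ltP s 0.
  exists 0 => x xs; have := le_lt_trans xs s0.
  by rewrite ltNge normr_ge0.
elim: nQ => [m c|m i a c P _ [M IH]|m a P _ [M IH]|m P1 P2 _ [M1 IH1] _ [M2 IH2]].
- by exists `|c|.
- exists ((`|a| * s + `|c|) * M) => x xs; rewrite normrM ler_pM ?IH//.
  apply: le_trans (ler_normD _ _) _; rewrite normrM lerD2r ler_wpM2l//.
  by move/(rV_norm_le _ s0) : xs; exact.
- by exists (`|a| * M) => x xs; rewrite normrM ler_wpM2l ?IH.
- by exists (M1 + M2) => x xs; apply: le_trans (ler_normD _ _) _; rewrite lerD ?IH1 ?IH2.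
Qed.

Lemma polydeg_line n Q x h : polydeg n Q ->
  exists2 q : {poly R}, (size q <= n.+1)%N & forall t, Q (x + t *: h) = q.[t].
Proof.
elim=> [m c|m i a c P _ [q qm qE]|m a P _ [q qm qE]|
  m P1 P2 _ [q1 q1m q1E] _ [q2 q2m q2E]].
- exists c%:P; first by rewrite size_polyC; case: (c != 0).
  by move=> t; rewrite hornerC.
- exists (((a * h ord0 i) *: 'X + (a * x ord0 i + c)%:P) * q); last first.
    by move=> t; rewrite qE hornerM hornerD hornerZ hornerX hornerC !mxE; ring.
  apply: leq_trans (size_polyMleq _ _) _.
  suff : (size ((a * h ord0 i) *: 'X + (a * x ord0 i + c)%:P)%R <= 2)%N.
    by move: qm; lia.
  apply: leq_trans (size_polyD _ _) _; rewrite geq_max; apply/andP; split.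
    by apply: leq_trans (size_scale_leq _ _) _; rewrite size_polyX.
  by rewrite size_polyC; case: (_ != 0).
- exists (a *: q); first by apply: leq_trans (size_scale_leq _ _) _.
  by move=> t; rewrite qE hornerZ.
- exists (q1 + q2); last by move=> t; rewrite q1E q2E hornerD.
  by apply: leq_trans (size_polyD _ _) _; rewrite geq_max q1m.
Qed.
End mixed_differences.

Section newton.
Context {R : realType} {d : nat}.
Local Notation V := 'rV[R]_d.
Implicit Types (I J : seq 'I_d) (H : R).

(* The binomial coefficient [t] over [k], as a polynomial in [t]. *)
Fixpoint rbin (k : nat) (t : R) : R :=
  if k is l.+1 then rbin l t * ((t - l%:R) / l.+1%:R) else 1.

Lemma rbinS_add1 k t : rbin k.+1 (t + 1) = rbin k t * ((t + 1) / k.+1%:R).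
Proof.
elim: k t => [|k IH] t; first by rewrite /= subr0.
rewrite [LHS]/= -/(rbin k.+1 (t + 1)) IH /=.
have k0 : (k%:R + 1 : R) != 0 by rewrite natr1 pnatr_eq0.
have k1 : (k%:R + 1 + 1 : R) != 0 by rewrite !natr1 pnatr_eq0.
by rewrite -!natr1; field; rewrite k0 k1.
Qed.

Lemma rbin_diff k t : rbin k.+1 (t + 1) - rbin k.+1 t = rbin k t.
Proof.
rewrite rbinS_add1 /=.
have k0 : (k%:R + 1 : R) != 0 by rewrite natr1 pnatr_eq0.
by rewrite -natr1; field.
Qed.

Definition newton H I (x : V) : R := \prod_i rbin (count_mem i I) (x ord0 i / H).

Lemma newton_nil H : newton H [::] = cst 1.
Proof. by apply/funext => x; rewrite /newton big1. Qed.

Lemma newton_diff H I j : H != 0 ->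
  (fun x => newton H I (x + H *: delta_mx 0 j) - newton H I x) =
  if j \in I then newton H (rem j I) else cst 0.
Proof.
move=> H0; apply/funext => x; rewrite /newton.
have xj i : (x + H *: delta_mx 0 j) ord0 i / H = x ord0 i / H + (i == j)%:R.
  by rewrite !mxE /= mulrDl mulrAC mulfV// mul1r.
under eq_bigr do rewrite xj.
rewrite (bigD1 j)//= [X in _ - X](bigD1 j)//= eqxx.
rewrite (eq_bigr (fun i => rbin (count_mem i I) (x ord0 i / H))); last first.
  by move=> i /negbTE ->; rewrite addr0.
rewrite -mulrBl; case: ifPn => jI /=.
  rewrite [RHS](bigD1 j)//= count_mem_rem eqxx.
  have : (0 < count_mem j I)%N by rewrite -has_count has_pred1.
  case: (count_mem j I) => // k _; rewrite rbin_diff subn1; congr (_ * _).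
  apply: eq_bigr => i ij; congr (rbin _ _).
  by rewrite count_mem_rem eq_sym (negbTE ij) subn0.
by rewrite (count_memPn jI) /= subrr mul0r.
Qed.

Lemma mdiff_newton H I J : H != 0 -> size J = size I ->
  mdiff [seq H *: delta_mx 0 j | j <- J] (newton H I) =
  cst (perm_eq J I)%:R.
Proof.
move=> H0; elim: J I => [|j J IH] I /=.
  by move/esym/size0nil ->; rewrite newton_nil.
move=> JI; rewrite -mdiff_diff newton_diff//; case: ifPn => jI.
  rewrite IH; last by rewrite size_rem// -JI.
  congr (cst _%:R); rewrite (permPr (perm_to_rem jI)).
  by rewrite perm_cons.
rewrite mdiff_cst0; congr (cst _); case: (boolP (perm_eq _ _)) => //.
by move/perm_mem/(_ j); rewrite (negbTE jI) inE eqxx.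
Qed.

Lemma polydeg_rbin H n k (i : 'I_d) (Q : V -> R) : polydeg n Q ->
  polydeg (k + n) (fun x => rbin k (x ord0 i / H) * Q x).
Proof.
elim: k n Q => [|k IH] n Q nQ /=.
  by under eq_fun do rewrite mul1r.
have := IH _ _ (polydeg_mul i (H^-1 / k.+1%:R) (- k%:R / k.+1%:R) nQ).
rewrite addnS -addSn; congr polydeg; apply/funext => x.
ring.
Qed.

Lemma polydeg_newton H I : polydeg (size I) (newton H I).
Proof.
have -> : size I = (\sum_i count_mem i I)%N.
  elim: I => [|j I IH] /=; first by rewrite big1.
  rewrite big_split /= -IH (bigD1 j)//= eqxx big1 ?addn0//.
  by move=> i; rewrite eq_sym => /negbTE ->.
suff P (r : seq 'I_d) : polydeg (\sum_(i <- r) count_mem i I)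
    (fun x => \prod_(i <- r) rbin (count_mem i I) (x ord0 i / H)) by exact: P.
elim: r => [|i r IH].
  rewrite [X in polydeg _ X](_ : _ = (fun=> 1)); first exact: polydeg_cst.
  by apply/funext => x; rewrite big_nil.
rewrite big_cons [X in polydeg _ X](_ : _ = (fun x : V =>
    rbin (count_mem i I) (x ord0 i / H) *
    \prod_(i <- r) rbin (count_mem i I) (x ord0 i / H))).
  exact: polydeg_rbin.
by apply/funext => x; rewrite big_cons.
Qed.
End newton.

Lemma almost_additive1 (R : realType) (f : R -> R) (H A B M : R) : 0 < H ->
  (forall s t, `|s| <= H -> `|t| <= H -> `|s + t| <= H ->
    `|f (s + t) - f s - f t| <= A) ->
  (forall t, `|t| <= H -> `|f t| <= M) -> `|f H| <= B ->
  forall t, `|t| <= H -> `|f t| <= 7 * A + 4 * B.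
Proof.
move=> H0 fA fM fB.
have A0 : 0 <= A.
  by apply: le_trans (fA 0 0 _ _ _); rewrite ?addr0 ?normr0// ltW.
have B0 : 0 <= B by exact: le_trans fB.
pose S := sup [set `|f t| | t in [set t | 0 <= t <= H]].
have inH t : 0 <= t <= H -> `|t| <= H by case/andP => t0 tH; rewrite ger0_norm.
have fS t : 0 <= t <= H -> `|f t| <= S.
  move=> tH; apply: ub_le_sup; last by exists t.
  by exists M => _ [u uH <-]; exact/fM/inH.
have SA : S <= S / 2 + (3 / 2 * A + B).
  apply: ge_sup; first by exists `|f 0|, 0 => //=; rewrite lexx ltW.
  move=> _ [t tH <-].
  have half u : 0 <= u <= H / 2 -> `|f u| <= (S + A) / 2.
    move=> /andP[u0 uH].
    have uu : 0 <= u + u <= H by apply/andP; split; lra.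
    have u1 : 0 <= u <= H by apply/andP; split; lra.
    have /ler_normlP[h1 h2] := fA u u (inH _ u1) (inH _ u1) (inH _ uu).
    have /ler_normlP[h3 h4] := fS _ uu.
    by apply/ler_normlP; split; lra.
  have [tH2|tH2] := leP t (H / 2).
    have := half t; move: tH => /andP[-> _]; rewrite tH2 => /(_ isT); lra.
  have t' : 0 <= H - t <= H / 2 by move/andP : tH => [? ?]; apply/andP; split; lra.
  have t'' : 0 <= H - t <= H by move/andP : tH => [? ?]; apply/andP; split; lra.
  have /ler_normlP[h1 h2] := half _ t'.
  have := fA _ _ (inH _ tH) (inH _ t''); rewrite subrKC gtr0_norm// lexx.
  move=> /(_ isT)/ler_normlP[h3 h4]; move/ler_normlP : fB => [h5 h6].
  by apply/ler_normlP; split; lra.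
have {}fS t : 0 <= t <= H -> `|f t| <= 3 * A + 2 * B.
  by move=> /fS ft; lra.
move=> t tH; have [t0|/ltW t0] := leP 0 t.
  apply: le_trans (fS t _) _; last lra.
  by rewrite t0; apply: le_trans tH; exact: ler_norm.
have nt : 0 <= - t <= H.
  by move/ler_normlP : (tH) => [? _]; apply/andP; split; lra.
have z : 0 <= (0 : R) <= H by apply/andP; split; lra.
have := fA t (- t) tH; rewrite subrr normr0 normrN => /(_ tH (ltW H0))/ler_normlP[h1 h2].
have /ler_normlP[h3 h4] := fS _ nt.
have /ler_normlP[h5 h6] := fS _ z.
by apply/ler_normlP; split; lra.
Qed.

Lemma almost_additive (R : realType) (d : nat) (H A B : R) : 0 < H ->
  exists K, forall (f : 'rV[R]_d -> R) (M : R),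
  (forall h k, `|h| <= H -> `|k| <= H -> `|h + k| <= H ->
    `|f (h + k) - f h - f k| <= A) ->
  (forall h, `|h| <= H -> `|f h| <= M) ->
  (forall i, `|f (H *: delta_mx 0 i)| <= B) ->
  forall h, `|h| <= H -> `|f h| <= K.
Proof.
move=> H0; exists (A + d%:R * (8 * A + 4 * B)) => f M fA fM fB h hH.
have delta_le (i : 'I_d) t : `|t| <= H -> `|t *: (delta_mx 0 i : 'rV[R]_d)| <= H.
  move=> tH; apply/(rV_norm_le _ (ltW H0)) => j; rewrite !mxE eqxx /=.
  by case: (j == i); rewrite ?mulr1// mulr0 normr0 ltW.
have f1 i t : `|t| <= H -> `|f (t *: delta_mx 0 i)| <= 7 * A + 4 * B.
  apply: (@almost_additive1 _ (fun t => f (t *: delta_mx 0 i)) H A B M) => //.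
    by move=> s u sH uH suH; rewrite scalerDl fA -?scalerDl ?delta_le.
  by move=> u uH; exact/fM/delta_le.
pose x n := \row_j (if (j < n)%N then h ord0 j else 0).
have xH n : `|x n| <= H.
  apply/(rV_norm_le _ (ltW H0)) => j; rewrite mxE; case: ifP => _.
    by move/(rV_norm_le _ (ltW H0)) : hH.
  by rewrite normr0 ltW.
have fx n : (n <= d)%N -> `|f (x n)| <= A + n%:R * (8 * A + 4 * B).
  elim: n => [_|n IH nd].
    have -> : x 0%N = 0 by apply/rowP => j; rewrite !mxE.
    have := fA 0 0; rewrite addr0 normr0 subrr sub0r normrN => /(_ (ltW H0) (ltW H0) (ltW H0)).
    lra.
  have xS : x n.+1 = x n + h ord0 (Ordinal nd) *: delta_mx 0 (Ordinal nd).
    apply/rowP => j; rewrite !mxE eqxx /= ltnS leq_eqVlt -val_eqE /=.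
    have [jn|jn] := eqVneq (j : nat) n.
      rewrite jn ltnn mulr1 add0r; congr (h _ _); exact/val_inj.
    by rewrite mulr0 addr0.
  have hn : `|h ord0 (Ordinal nd)| <= H by move/(rV_norm_le _ (ltW H0)) : hH; exact.
  have := fA _ _ (xH n) (delta_le (Ordinal nd) _ hn); rewrite -xS => /(_ (xH _)) h1.
  have h2 := IH (ltnW nd).
  have h3 := f1 (Ordinal nd) _ hn.
  move/ler_normlP : h1 => [? ?]; move/ler_normlP : h2 => [? ?].
  move/ler_normlP : h3 => [? ?]; rewrite -natr1 mulrDl mul1r.
  by apply/ler_normlP; split; lra.
have <- : x d = h by apply/rowP => j; rewrite mxE ltn_ord.
exact: fx.
Qed.

Section mixed_difference_bounds.
Context {R : realType} {d : nat} (p : \bar R) (z : 'rV[R]_d) (s : R).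
Hypotheses (p0 : (0 < p)%E) (s0 : 0 < s).
Local Notation V := 'rV[R]_d.
Implicit Types (h k x : V) (hs ks : seq V) (f g Q : V -> R) (C : R).
Local Notation S := (cube z s).
Local Notation H := (2 * s).
Local Notation small := (all (fun h : V => `|h| <= H)).

Let H0 : 0 < H. Proof. by rewrite mulr_gt0. Qed.
Let mS : measurable S. Proof. exact: measurable_cube. Qed.

Lemma adm_mdiff hs f : adm p f -> adm p (mdiff hs f).
Proof.
move=> af; elim: hs => //= h hs IH.
exact: (admB (adm_shift h IH) IH).
Qed.

Lemma adm_polydeg n Q : polydeg n Q -> adm p Q.
Proof. by move=> nQ; case: p => //= q; exact: polydeg_measurable nQ. Qed.

Lemma gauge_cube_bounded (M : R) : 0 <= M -> exists K, forall f, adm p f ->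
  (forall x, S x -> `|f x| <= M) -> (gauge p S f <= K%:E)%E.
Proof. by move=> M0; apply: gauge_bounded => //; exact: lebesgue_cube_lty. Qed.

(* Polarization: the r-fold mixed difference with steps h_1, .., h_r is, up to
   sign, the term j = 0 of the sum over j of (-1)^(r+j) C(r,j) times the mixed
   difference with steps (1 - j/i) h_i at x + a + j b; for 0 < j <= r the step
   with i = j vanishes. Removing the steps one by one turns that sum into
   differences of order r in a single direction. *)
Let polar r f (L : seq (nat * V)) (a b : V) : V -> R := fun x =>
  \sum_(j < r.+1) (-1) ^+ (r + j) * 'C(r, j)%:R *
    mdiff [seq (1 - j%:R / w.1%:R) *: w.2 | w <- L] f (x + a + b *+ j).

Let adm_polar r f L a b : adm p f -> adm p (polar r f L a b).
Proof.
move=> af; apply: adm_sum => j; apply: admZ.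
have -> : (fun x => mdiff [seq (1 - j%:R / w.1%:R) *: w.2 | w <- L] f (x + a + b *+ j)) =
    (fun x => mdiff [seq (1 - j%:R / w.1%:R) *: w.2 | w <- L] f (x + (a + b *+ j))).
  by apply/funext => x; rewrite addrA.
exact/adm_shift/adm_mdiff.
Qed.

Let polar_cons r f i h L a b :
  polar r f ((i, h) :: L) a b =
  polar r f L (a + h) (b - i%:R^-1 *: h) \- polar r f L a b.
Proof.
apply/funext => x; rewrite /= /polar -sumrB; apply: eq_bigr => j _ /=.
rewrite -mulrBr; congr (_ * (mdiff _ _ _ - _)).
have -> : (1 - j%:R / i%:R) *: h = h - (i%:R^-1 *: h) *+ j.
  by rewrite scalerBl scale1r mulrC -scaler_nat scalerA mulrC.
by rewrite mulrnBl !addrA; congr (_ - _); rewrite -!addrA; congr (_ + (_ + _)); rewrite addrC.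
Qed.

Let polar_bound r C n : exists K, forall f, adm p f ->
  (forall a b, `|a| <= r%:R * H -> `|b| <= r%:R * H ->
    (gauge p S (fun x => finite_diff r b f (x + a)) <= C%:E)%E) ->
  forall L a b, size L = n -> (n <= r)%N ->
  all (fun w => (0 < w.1)%N && (`|w.2| <= H)) L ->
  `|a| <= (r - n)%:R * H -> `|b| <= (r - n)%:R * H ->
  (gauge p S (polar r f L a b) <= K%:E)%E.
Proof.
elim: n => [|n [K IH]].
  exists C => f af fC [|//] a b _ _ _; rewrite subn0 => aH bH.
  exact: fC.
have [K' HK'] := gaugeB (d := d) K K p0; exists K' => f af fC [//|[i h] L] a b [Ln] nr.
move=> /= /andP[/andP[i0 hH] LH] aH bH; rewrite polar_cons.
have e : (r - n)%:R * H = (r - n.+1)%:R * H + H :> R.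
  by rewrite -(subnSK nr) -natr1 mulrDl mul1r.
apply: HK' => //; try exact: adm_polar.
- apply: IH => //; first exact: ltnW.
    by rewrite e; apply: le_trans (ler_normD _ _) _; exact: lerD.
  rewrite e; apply: le_trans (ler_normB _ _) _; apply: lerD => //.
  rewrite normrZ; apply: le_trans hH; rewrite -[leRHS]mul1r ler_wpM2r//.
  by rewrite ger0_norm ?invr_ge0// invf_le1 ?ltr0n// ler1n.
- apply: IH => //; first exact: ltnW.
    by rewrite e; apply: le_trans aH _; rewrite lerDl ltW.
  by rewrite e; apply: le_trans bH _; rewrite lerDl ltW.
Qed.

Lemma gauge_mdiff_bound r C : exists K, forall f, adm p f ->
  (forall a b, `|a| <= r%:R * H -> `|b| <= r%:R * H ->
    (gauge p S (fun x => finite_diff r b f (x + a)) <= C%:E)%E) ->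
  forall hs, size hs = r -> small hs -> (gauge p S (mdiff hs f) <= K%:E)%E.
Proof.
have [K HK] := polar_bound r C r.
have [K' HK'] := gaugeZ_le (d := d) ((-1) ^+ r) K p0.
exists K' => f af fC hs hr hH.
pose L := zip (iota 1 r) hs.
have Lr : size L = r by rewrite size_zip size_iota hr minnn.
have LH : all (fun w => (0 < w.1)%N && (`|w.2| <= H)) L.
  apply/allP => -[i h] /= iL; apply/andP; split.
    have : i \in unzip1 L by apply/mapP; exists (i, h).
    by rewrite unzip1_zip ?size_iota ?hr// mem_iota => /andP[].
  move/allP : hH; apply.
  have : h \in unzip2 L by apply/mapP; exists (i, h).
  by rewrite unzip2_zip ?size_iota ?hr.
suff <- : (-1) ^+ r \*o polar r f L 0 0 = mdiff hs f.
  apply: HK' => //; first exact: adm_polar.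
  by apply: HK => //; rewrite subnn mul0r normr0.
apply/funext => x; rewrite /= /polar big_ord_recl /= big1 => [|j _].
  rewrite addn0 bin0 mulr1 addr0 mulrA -expr2 sqrr_sign mul1r mulr0n !addr0.
  congr (mdiff _ f x); rewrite -[RHS](@unzip2_zip _ _ (iota 1 r)) ?size_iota ?hr//.
  by apply: eq_map => w /=; rewrite mul0r subr0 scale1r.
rewrite mdiff0 ?mulr0//; apply/mapP.
have jr : (j < size L)%N by rewrite Lr.
exists (nth (0%N, 0) L j); first exact: mem_nth.
rewrite nth_zip ?size_iota ?hr//= nth_iota// add1n divff ?pnatr_eq0//.
by rewrite subrr scale0r.
Qed.

Lemma mdiff_bounded n Q m : polydeg n Q -> exists2 M, 0 <= M &
  forall hs x, size hs = m -> small hs -> S x -> `|mdiff hs Q x| <= M.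
Proof.
move=> nQ; suff [M QM] : exists M, forall hs x, size hs = m -> small hs ->
    S x -> `|mdiff hs Q x| <= M.
  exists `|M| => // hs x hm hH Sx; apply: le_trans (QM _ _ hm hH Sx) _.
  exact: ler_norm.
have [M QM] := polydeg_bounded (`|z| + s + m%:R * H) nQ.
exists (2 ^+ m * M) => hs x hm hH Sx.
have : `|x| <= `|z| + s.
  by rewrite -[x](subrK z) addrC; apply: le_trans (ler_normD _ _) _; rewrite lerD2l.
move: hH {Sx}; rewrite -hm in QM *.
move: (`|z| + s) QM x; elim: hs {hm} => [|h hs IH] t QM x /=.
  by rewrite expr0 mul1r => _ xt; apply: QM; rewrite mul0r addr0.
move=> /andP[hH hsH] xt; apply: le_trans (ler_normB _ _) _.
have QM' y : `|y| <= t + H + (size hs)%:R * H -> `|Q y| <= M.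
  by move=> yt; apply: QM; apply: le_trans yt _; rewrite /= -natr1; lra.
have h1 := IH _ QM' (x + h) hsH (le_trans (ler_normD _ _) (lerD xt hH)).
have h2 := IH _ QM' x hsH (le_trans xt _); rewrite exprS.
have := h2 _; rewrite lerDl => /(_ (ltW H0)); lra.
Qed.
End mixed_difference_bounds.

Section polynomial_approximation.
Context {R : realType} {d : nat} (p : \bar R) (z : 'rV[R]_d) (s : R).
Hypotheses (p0 : (0 < p)%E) (s0 : 0 < s).
Local Notation V := 'rV[R]_d.
Implicit Types (h k x : V) (hs ks : seq V) (f g Q : V -> R) (C : R).
Implicit Types (I J : seq 'I_d).
Local Notation S := (cube z s).
Local Notation H := (2 * s).
Local Notation small := (all (fun h : V => `|h| <= H)).

Let H0 : 0 < H. Proof. by rewrite mulr_gt0. Qed.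
Let mS : measurable S. Proof. exact: measurable_cube. Qed.

Lemma polydeg_sum n (T : Type) (r : seq T) (P : pred T) (F : T -> V -> R) :
  (forall i, polydeg n (F i)) -> polydeg n (fun x => \sum_(i <- r | P i) F i x).
Proof.
move=> nF; elim: r => [|i r IH].
  rewrite [X in polydeg _ X](_ : _ = (fun=> 0)); first exact: polydeg_cst.
  by apply/funext => x; rewrite big_nil.
rewrite [X in polydeg _ X](_ : _ = (fun x => if P i then
   F i x + \sum_(i <- r | P i) F i x else \sum_(i <- r | P i) F i x)).
  by case: (P i) => //; exact: polydegD.
by apply/funext => x; rewrite big_cons.
Qed.

Let bas I : seq V := [seq H *: delta_mx 0 i | i <- I].

Let bas_small I : small (bas I).
Proof.
apply/allP => _ /mapP[i _ ->]; apply/(rV_norm_le _ (ltW H0)) => j.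
rewrite !mxE eqxx /=; case: (j == i); rewrite ?mulr1 ?mulr0.
  by rewrite gtr0_norm.
by rewrite normr0 ltW.
Qed.

Let tau K f hs : R :=
  xget 0 [set c | (gauge p S (fun x => mdiff hs f x - c)%R <= K%:E)%E].

Let tau_perm K f hs ks : perm_eq hs ks -> tau K f hs = tau K f ks.
Proof. by move=> hk; rewrite /tau (mdiff_perm _ hk). Qed.

Let ord_le (i j : 'I_d) := (i <= j)%N.

Let top K f m : V -> R := fun x =>
  \sum_(I : m.-tuple 'I_d | sorted ord_le I)
    tau K f (bas I) * newton H I x.

Let polydeg_top K f m : polydeg m (top K f m).
Proof.
rewrite /top; apply: polydeg_sum => I; apply: polydegZ.
by have := polydeg_newton H I; rewrite size_tuple.
Qed.

Let mdiff_top K f m J : size J = m -> mdiff (bas J) (top K f m) = cst (tau K f (bas J)).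
Proof.
move=> Jm; rewrite /top mdiff_sum; apply/funext => x.
have sm : size (sort ord_le J) == m by rewrite size_sort Jm.
have tot : total ord_le by move=> i j; exact: leq_total.
have sJ : perm_eq J (sort ord_le J) by rewrite perm_sym perm_sort.
under eq_bigr => I _.
  rewrite -[X in mdiff _ X]/(tau K f (bas I) \*o newton H I) mdiffZ.
  rewrite mdiff_newton ?gt_eqF ?size_tuple//= [_%:R]/=; over.
rewrite (bigD1 (Tuple sm)) /=; last exact: sort_sorted.
rewrite sJ mulr1 big1 ?addr0; first by apply: tau_perm; rewrite perm_map// perm_sym.
move=> I /andP[Is In]; case: (boolP (perm_eq J I)) => JI; last by rewrite mulr0.
case/eqP: In; apply: val_inj => /=; apply: (@sorted_eq _ ord_le) => //.
- by move=> i j k; exact: leq_trans.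
- by move=> i j /andP[ij ji]; apply/val_inj/eqP; rewrite eqn_leq; apply/andP.
- exact: sort_sorted.
- by rewrite perm_sym -(permPl sJ).
Qed.

Let mdiff_reduce m C : exists C', forall f, adm p f ->
  (forall hs, size hs = m.+1 -> small hs -> (gauge p S (mdiff hs f) <= C%:E)%E) ->
  (exists M, forall hs, size hs = m -> small hs ->
    (gauge p S (mdiff hs f) <= M%:E)%E) ->
  exists2 Q, polydeg m Q & forall hs, size hs = m -> small hs ->
    (gauge p S (mdiff hs (f \- Q)%R) <= C'%:E)%E.
Proof.
have [K HK] := gauge_near_cst z C p0 s0.
have [K2 HK2] := gaugeD (d := d) K K p0.
have [K3 HK3] := gaugeB (d := d) K2 K p0.
have [K4 HK4] := gaugeD (d := d) C K3 p0.
have [A HA] := gauge_cst_inv z K4 p0 s0.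
have /choice[Kf HKf] B := almost_additive d A B H0.
have [K5 HK5] := gauge_cube_bounded z p0 s0 (normr_ge0 (iter m Kf 0)).
have [K6 HK6] := gaugeD (d := d) K K5 p0.
exists K6 => f af fC [M fM].
pose Q := top K f m.
have mQ : polydeg m Q by exact: polydeg_top.
exists Q => //.
pose t := tau K f; pose kap hs := mdiff hs Q 0.
have kapE hs : size hs = m -> mdiff hs Q = cst (kap hs).
  by move=> hm; rewrite /kap; have [c ->] := mdiff_polydeg mQ hm.
have tP hs : size hs = m -> small hs ->
    (gauge p S (fun x => mdiff hs f x - t hs)%R <= K%:E)%E.
  move=> hm hH; rewrite /t /tau; case: xgetP => [c _ //|none].
  have [|k kH|c fc] := HK (mdiff hs f); first exact: adm_mdiff.
    by apply: (fC (k :: hs)); rewrite /= ?hm// kH.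
  by have := none c.
pose u hs := t hs - kap hs.
have u_perm hs ks : perm_eq hs ks -> u hs = u ks.
  by move=> hk; rewrite /u /t (tau_perm _ _ hk) /kap (mdiff_perm _ hk).
have u_bas J : size J = m -> u (bas J) = 0.
  by move=> Jm; rewrite /u /kap mdiff_top//= subrr.
have uM : exists M', forall hs, size hs = m -> small hs -> `|u hs| <= M'.
  have [M1 M10 QM1] := mdiff_bounded z s0 m mQ.
  have [K7 HK7] := gaugeB (d := d) M K p0.
  have [M2 HM2] := gauge_cst_inv z K7 p0 s0.
  exists (M2 + M1) => hs hm hH; apply: le_trans (ler_normB _ _) _; apply: lerD.
    apply: HM2.
    have -> : cst (t hs) = mdiff hs f \- (fun x => mdiff hs f x - t hs).
      by apply/funext => x /=; rewrite subKr.
    apply: HK7 => //; [exact: adm_mdiff| |exact: fM|exact: tP].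
    by apply: admB; [exact: adm_mdiff|exact: adm_cst].
  have := QM1 hs z hm hH; rewrite kapE//=; apply.
  by rewrite /cube /= subrr normr0 ltW.
have u_add h k hs : (size hs).+1 = m -> small hs -> `|h| <= H -> `|k| <= H ->
    `|h + k| <= H -> `|u (h + k :: hs) - u (h :: hs) - u (k :: hs)| <= A.
  move=> hm hsH hH kH hkH.
  have -> : u (h + k :: hs) - u (h :: hs) - u (k :: hs) =
      t (h + k :: hs) - t (h :: hs) - t (k :: hs).
    have := mdiff_polydeg0 mQ (_ : (m < size [:: h, k & hs])%N).
    rewrite /= hm ltnS leqnn => /(_ isT)/(congr1 (fun f => f 0)) /=.
    rewrite /u /kap /= !add0r => e.
    by move: e; lra.
  apply: HA.
  pose e hs x := mdiff hs f x - t hs.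
  have ae ks : adm p (e ks) by apply: admB; [exact: adm_mdiff|exact: adm_cst].
  have eK k' : `|k'| <= H -> (gauge p S (e (k' :: hs)) <= K%:E)%E.
    by move=> k'H; apply: tP; rewrite /= ?hm// k'H.
  have -> : cst (t (h + k :: hs) - t (h :: hs) - t (k :: hs)) =
      mdiff [:: h, k & hs] f \+ ((e (h :: hs) \+ e (k :: hs)) \- e (h + k :: hs)).
    by apply/funext => x; rewrite /e /= (addrA x h k); ring.
  apply: HK4 => //.
  - exact: adm_mdiff.
  - by apply: admB => //; exact: admD.
  - by apply: fC; rewrite /= ?hm// hH kH.
  - apply: HK3 => //; [exact: admD|apply: HK2 => //; exact: eK|exact: eK].
have u_bound j : forall hs J, size hs = j -> (j + size J = m)%N -> small hs ->
    `|u (hs ++ bas J)| <= iter j Kf 0.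
  elim: j => [|j IH] [|h hs]//= J; first by move=> _ Jm _; rewrite u_bas ?normr0.
  move=> [hj] jJ /andP[hH hsH].
  have hJ : (size (hs ++ bas J)).+1 = m by rewrite size_cat size_map hj -addSn.
  have sJ : small (hs ++ bas J) by rewrite all_cat hsH bas_small.
  have [M' HM'] := uM.
  apply: (HKf (iter j Kf 0) (fun h => u (h :: hs ++ bas J)) M') => //.
  - by move=> h1 k1 h1H k1H hk1; exact: u_add.
  - by move=> h1 h1H; apply: HM'; rewrite //= h1H.
  - move=> i; rewrite (u_perm _ (hs ++ bas (i :: J))).
      by apply: IH => //=; rewrite addnS -addSn.
    by rewrite -cat1s perm_catCA.
move=> hs hm hH.
have -> : mdiff hs (f \- Q) = (fun x => mdiff hs f x - t hs) \+ cst (u hs).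
  by rewrite mdiffB kapE//; apply/funext => x /=; rewrite /u; ring.
apply: HK6 => //.
- by apply: admB; [exact: adm_mdiff|exact: adm_cst].
- exact: adm_cst.
- exact: tP.
- apply: HK5 => [|x Sx]; first exact: adm_cst.
  have := u_bound m hs [::] hm (addn0 _) hH; rewrite cats0 => /le_trans; apply.
  exact: ler_norm.
Qed.

Lemma polydeg_approx m C : exists C', forall f, adm p f ->
  (forall hs, size hs = m.+1 -> small hs -> (gauge p S (mdiff hs f) <= C%:E)%E) ->
  (forall n, (n <= m)%N -> exists M, forall hs, size hs = n -> small hs ->
    (gauge p S (mdiff hs f) <= M%:E)%E) ->
  exists2 Q, polydeg m Q & (gauge p S (f \- Q)%R <= C'%:E)%E.
Proof.
elim: m C => [|m IH] C.
  have [C1 HC1] := mdiff_reduce 0 C; exists C1 => f af fC fM.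
  have [Q Q0 fQ] := HC1 f af fC (fM 0%N (leqnn _)).
  by exists Q => //; exact: (fQ [::]).
have [C1 HC1] := mdiff_reduce m.+1 C.
have [C2 HC2] := IH C1; exists C2 => f af fC fM.
have [Q mQ fQ] := HC1 f af fC (fM m.+1 (leqnn _)).
have aQ : adm p Q by exact: adm_polydeg mQ.
have [||n nm|Q' mQ' fQ'] := HC2 (f \- Q); [exact: admB|exact: fQ| |].
  have [M1 HM1] := fM n (leqW nm).
  have [M2 M20 QM2] := mdiff_bounded z s0 n mQ.
  have [K HK] := gauge_cube_bounded z p0 s0 M20.
  have [K' HK'] := gaugeB (d := d) M1 K p0.
  exists K' => hs hn hH; rewrite mdiffB; apply: HK' => //; try exact: adm_mdiff.
    exact: HM1.
  by apply: HK => [|x Sx]; [exact: adm_mdiff|exact: QM2].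
exists (Q \+ Q'); first by apply: polydegD => //; exact: polydegS.
by rewrite (_ : f \- _ = f \- Q \- Q')//; apply/funext => x /=; rewrite opprD addrA.
Qed.
End polynomial_approximation.

(** * Continuity of translations *)

Lemma measurable_gt (R : realType) (disp : measure_display)
    (T : measurableType disp) (g : T -> R) (a : R) :
  measurable_fun setT g -> measurable [set x | a < g x].
Proof.
move=> mg; rewrite (_ : [set x | a < g x] = g @^-1` [set` `]a, +oo[]).
  by rewrite -[X in measurable X]setTI; exact: mg.
by apply/seteqP; split => x; rewrite /= in_itv /= andbT.
Qed.

Lemma measure_small (R : realType) (disp : measure_display)
    (T : measurableType disp) (mu : {measure set T -> \bar R})
    (F : (set T)^nat) (e : R) :
  (mu (F 0%N) < +oo)%E -> (forall n, measurable (F n)) ->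
  (forall m n, (m <= n)%N -> F n `<=` F m) -> \bigcap_n F n = set0 -> 0 < e ->
  exists n, (mu (F n) <= e%:E)%E.
Proof.
move=> F0 mF niF F00 e0.
have : mu \o F @ \oo --> mu (\bigcap_n F n).
  apply: nonincreasing_cvg_mu => //; first exact: bigcapT_measurable.
  by move=> m n mn; apply/subsetPset; exact: niF.
rewrite F00 measure0 => /(_ [set y | (y < e%:E)%E]) [|N _ HN].
  by apply: open_ereal_lt'; rewrite lte_fin.
by exists N; apply/ltW/HN => /=.
Qed.

Section translation_continuity.
Context {R : realType} {d : nat}.
Local Notation V := 'rV[R]_d.
Local Notation mu := (lebesgue_rV R d).
Implicit Types (A B : set V) (h : V) (s e : R).

Let moved A h : set V :=
  [set x | (A x /\ ~ A (x + h)) \/ (~ A x /\ A (x + h))].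

Let preshift A h := (fun x => x + h) @^-1` A.

Let measurable_preshift A h : measurable A -> measurable (preshift A h).
Proof. exact: measurable_preimage_shift. Qed.

Let measurable_moved A h : measurable A -> measurable (moved A h).
Proof.
move=> mA; rewrite (_ : moved A h = (A `\` preshift A h) `|` (preshift A h `\` A)).
  by apply: measurableU; apply: measurableD => //; exact: measurable_preshift.
by apply/seteqP; split => x [[? ?]|[? ?]]; [left|right|left|right].
Qed.

Let tcont A := measurable A /\ forall s e, 0 < s -> 0 < e ->
  exists2 n : R, 0 < n & forall h, `|h| < n -> (mu (cube 0%R s `&` moved A h) <= e%:E)%E.

Let tcontU A B : tcont A -> tcont B -> tcont (A `|` B).
Proof.
move=> [mA cA] [mB cB]; split; first exact: measurableU.
move=> s e s0 e0; have e20 : 0 < e / 2 by rewrite divr_gt0.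
have [n1 n10 A1] := cA _ _ s0 e20; have [n2 n20 B1] := cB _ _ s0 e20.
exists (Num.min n1 n2) => [|h]; first by rewrite lt_min n10.
rewrite lt_min => /andP[h1 h2].
apply: (@le_trans _ _ (mu ((cube 0 s `&` moved A h) `|` (cube 0 s `&` moved B h)))).
  have mc := measurable_cube (0 : V) s.
  apply: le_measure; rewrite ?inE.
  - by apply: measurableI => //; apply: measurable_moved; exact: measurableU.
  - by apply: measurableU; apply: measurableI => //; exact: measurable_moved.
  move=> x [Sx [[ABx ABh]|[ABx ABh]]].
    have [nA nB] : ~ A (x + h) /\ ~ B (x + h) by split=> ?; apply: ABh; [left|right].
    by case: ABx => ?; [left|right]; split => //; left.
  have [nA nB] : ~ A x /\ ~ B x by split=> ?; apply: ABx; [left|right].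
  by case: ABh => ?; [left|right]; split => //; right.
apply: le_trans (measureU2 _ _ _) _.
- by apply: measurableI; [exact: measurable_cube|exact: measurable_moved].
- by apply: measurableI; [exact: measurable_cube|exact: measurable_moved].
by rewrite [e]splitr EFinD leeD// ?A1 ?B1.
Qed.

Let tcont_bigcup (F : (set V)^nat) : (forall n, tcont (F n)) -> tcont (\bigcup_n F n).
Proof.
move=> tF; have mF : measurable (\bigcup_n F n).
  by apply: bigcup_measurable => n _; case: (tF n).
split=> // s e s0 e0; have e30 : 0 < e / 3 by rewrite divr_gt0.
pose U n := \big[setU/set0]_(i < n) F i.
have mU n : measurable (U n) by apply: bigsetU_measurable => i _; case: (tF i).
have tU n : tcont (U n).
  rewrite /U; elim: n => [|n IH]; last by rewrite big_ord_recr /=; exact: tcontU.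
  rewrite big_ord0; split=> // s' e' _ e'0; exists 1 => // h _.
  rewrite (_ : _ `&` _ = set0) ?measure0 ?lee_fin ?ltW//.
  by apply/seteqP; split => // x [_ [[]|[]]].
pose T n := cube 0 (s + 1) `&` (\bigcup_n F n `\` U n).
have mc := measurable_cube (0 : V) (s + 1).
have mT n : measurable (T n) by apply: measurableI => //; exact: measurableD.
have [N TN] : exists N, (mu (T N) <= (e / 3)%:E)%E.
  apply: measure_small => //.
  - apply: le_lt_trans (lebesgue_cube_lty (0 : V) (_ : 0 < s + 1)); last exact: addr_gt0.
    by apply: le_measure; rewrite ?inE//; exact: subIsetl.
  - move=> m n mn; apply: setIS; apply: setDS.
    rewrite /U -!bigcup_mkord => x [i im Fi]; exists i => //=; exact: leq_trans mn.
  apply/seteqP; split => // x Tx; have [_ [[n _ Fn] _]] := Tx 0%N I.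
  have [_ [_]] := Tx n.+1 I; apply.
  by rewrite /U big_ord_recr; right.
have [n n0 Un] := (tU N).2 _ _ s0 e30.
exists (Num.min n 1) => [|h]; first by rewrite lt_min n0 ltr01.
rewrite lt_min => /andP[hn h1].
set S := cube 0 s.
have mS : measurable S by exact: measurable_cube.
apply: (@le_trans _ _ (mu ((S `&` moved (U N) h) `|` (T N `|` preshift (T N) h)))).
  apply: le_measure; rewrite ?inE.
  - by apply: measurableI => //; exact: measurable_moved.
  - apply: measurableU; first by apply: measurableI => //; exact: measurable_moved.
    by apply: measurableU => //; exact: measurable_preshift.
  have UF x : U N x -> (\bigcup_n F n) x by rewrite /U -bigcup_mkord => -[i _ Fi]; exists i.
  have S1 x : S x -> cube 0 (s + 1) x.
    by rewrite /S /cube /= => xs; apply: le_trans xs _; rewrite lerDl.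
  have S2 x : S x -> cube 0 (s + 1) (x + h).
    rewrite /S /cube /= !subr0 => xs; apply: le_trans (ler_normD _ _) _.
    by rewrite lerD// ltW.
  move=> x [Sx [[Fx Fh]|[Fx Fh]]].
    have [Ux|Ux] := pselect (U N x); last by right; left; split; [exact: S1|].
    by left; split=> //; left; split=> // /UF.
  have [Uh|Uh] := pselect (U N (x + h)); last by right; right; split; [exact: S2|].
  by left; split=> //; right; split=> // /UF.
apply: le_trans (measureU2 _ _ _) _.
- by apply: measurableI => //; exact: measurable_moved.
- by apply: measurableU => //; exact: measurable_preshift.
rewrite (_ : e = e / 3 + (e / 3 + e / 3)); last by field.
rewrite EFinD; apply: leeD; first exact: Un.
apply: le_trans (measureU2 _ _ _) _ => //; first exact: measurable_preshift.
by rewrite EFinD; apply: leeD => //; rewrite [leLHS](lebesgue_rV_shift h (mT N)).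
Qed.

Let tcont_sigma_algebra : sigma_algebra setT tcont.
Proof.
split=> [|A [mA cA]|F]; last exact: tcont_bigcup.
  split=> // s e _ e0; exists 1 => // h _.
  rewrite (_ : _ `&` _ = set0) ?measure0 ?lee_fin ?ltW//.
  by apply/seteqP; split => // x [_ [[]|[]]].
rewrite setTD; split; first exact: measurableC.
move=> s e s0 e0; have [n n0 cn] := cA s e s0 e0; exists n => // h hn.
rewrite (_ : moved (~` A) h = moved A h); first exact: cn.
apply/seteqP; split => x [[Ax Ah]|[Ax Ah]].
- by right; split => //; exact: contrapT.
- by left; split => //; exact: contrapT.
- by right; split => //; exact.
- by left; split => //; exact.
Qed.

Let measurable_slab (i : 'I_d) (a n : R) : measurable [set x : V | `|x ord0 i - a| <= n].
Proof.
have -> : [set x : V | `|x ord0 i - a| <= n] = rV_coor i @^-1` [set` `[a - n, a + n]].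
  by apply/seteqP; split => x; rewrite /rV_coor /= in_itv /= ler_distl.
by rewrite -[X in measurable X]setTI; exact: measurable_rV_coor.
Qed.

Let slab_measure (i : 'I_d) (a s : R) : 0 < s ->
  exists2 c : R, 0 <= c & forall n : R, 0 <= n ->
  (mu (cube 0%R s `&` [set x | (`|x ord0 i - a| <= n)%R]) <= (2 * n * c)%:E)%E.
Proof.
move=> s0; exists (\prod_(j < d | j != i) (2 * s)).
  by rewrite prodr_const exprn_ge0// mulr_ge0// ltW.
move=> n n0.
pose A j := if j == i then [set` `[a - n, a + n]] else [set` `[- s, s]] : set R.
have mA j : measurable (A j) by rewrite /A; case: ifP.
apply: (@le_trans _ _ (mu [set x | forall j, A j (x ord0 j)])).
  apply: le_measure; rewrite ?inE; last 2 first.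
  - exact: measurable_rV_box.
  - move=> x [/(rV_norm_le _ (ltW s0)) xs /= xa] j; rewrite /A.
    have [->|_] := eqVneq j i; first by rewrite /= in_itv/= -ler_distl.
    by have := xs j; rewrite /= subr0 in_itv/= ler_norml.
  by apply: measurableI; [exact: measurable_cube|exact: measurable_slab].
rewrite lebesgue_rV_box//.
rewrite (eq_bigr (fun j => (if j == i then 2 * n else 2 * s)%:E)); last first.
  move=> j _; rewrite /A; case: ifP => _; rewrite lebesgue_measure_itv/= lte_fin.
    by case: ltP => an; rewrite -?EFinB; congr EFin; lra.
  by case: ltP => an; rewrite -?EFinB; congr EFin; lra.
rewrite prodEFin lee_fin (bigD1 i)//= eqxx.
by rewrite (eq_bigr (fun=> 2 * s))// => j /negbTE ->.
Qed.

Let tcont_coord (i : 'I_d) (B : set R) : measurable B -> tcont (rV_coor i @^-1` B).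
Proof.
pose G : set (set R) := [set B | tcont (rV_coor i @^-1` B)].
have sG : sigma_algebra setT G.
  have [t0 tC tU] := tcont_sigma_algebra; split.
  - by rewrite /G /= preimage_set0.
  - by move=> A /tC; rewrite /G /= !setTD.
  - by move=> F tF; rewrite /G /= preimage_bigcup; exact: tU.
move=> mB; suff: G B by [].
suff: (@RGenOInfty.G R).-sigma.-measurable `<=` G.
  by apply; rewrite -RGenOInfty.measurableE; exact: mB.
apply: smallest_sub => // _ [a ->]; split.
  by rewrite -[X in measurable X]setTI; apply: measurable_rV_coor.
move=> s e s0 e0; have [c c0 slab] := slab_measure i a s0.
exists (e / (2 * (c + 1))) => [|h hn].
  by rewrite divr_gt0// mulr_gt0// ltr_wpDl.
have n0 : 0 <= e / (2 * (c + 1)) by rewrite divr_ge0 ?mulr_ge0 ?addr_ge0// ltW.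
apply: (@le_trans _ _ (2 * (e / (2 * (c + 1))) * c)%:E); last first.
  have -> : 2 * (e / (2 * (c + 1))) * c = e * (c / (c + 1)).
    by field; rewrite gt_eqF// ltr_wpDl.
  by rewrite lee_fin ler_piMr ?ltW// ltr_pdivrMr ?mul1r ?ltrDl// ltr_wpDl.
apply: le_trans (slab _ n0); apply: le_measure; rewrite ?inE.
- apply: measurableI; first exact: measurable_cube.
  apply: measurable_moved; rewrite -[X in measurable X]setTI.
  exact: measurable_rV_coor.
- by apply: measurableI; [exact: measurable_cube|exact: measurable_slab].
move=> x [Sx xh]; split=> //=.
have /ler_normlP[h1 h2] : `|h ord0 i| <= e / (2 * (c + 1)).
  by have /ltW/(rV_norm_le _ n0) := hn; exact.
apply/ler_normlP; move: xh; rewrite /moved /= /rV_coor !in_itv /= !andbT !mxE.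
by case=> [[xa /negP]|[/negP + xa]]; rewrite -leNgt => ?; split; lra.
Qed.

Let tcont_measurable A : measurable A -> tcont A.
Proof.
suff: @measurable _ V `<=` tcont by apply.
apply: smallest_sub; first exact: tcont_sigma_algebra.
rewrite -bigcup_seq/=; apply: bigcup_sub => i _ _ [B mB <-]; rewrite setTI.
exact: tcont_coord.
Qed.

Let moved_finite (A : nat -> set V) n s e : (forall i, measurable (A i)) ->
  0 < s -> 0 < e -> exists2 t : R, 0 < t & forall h, `|h| < t ->
  (mu (cube 0%R s `&` \big[setU/set0]_(i < n) moved (A i) h) <= e%:E)%E.
Proof.
move=> mA s0; elim: n e => [|n IH] e e0.
  by exists 1 => // h _; rewrite big_ord0 setI0 measure0 lee_fin ltW.
have e20 : 0 < e / 2 by rewrite divr_gt0.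
have [t1 t10 H1] := IH _ e20.
have [t2 t20 H2] := (tcont_measurable (mA n)).2 _ _ s0 e20.
exists (Num.min t1 t2) => [|h]; first by rewrite lt_min t10.
rewrite lt_min => /andP[h1 h2]; rewrite big_ord_recr /= setIUr.
have mm i : measurable (moved (A i) h) by exact: measurable_moved.
apply: le_trans (measureU2 _ _ _) _.
- apply: measurableI; first exact: measurable_cube.
  exact: bigsetU_measurable.
- by apply: measurableI; first exact: measurable_cube.
by rewrite [e]splitr EFinD leeD// ?H1 ?H2.
Qed.

Lemma translation_continuous (f : V -> R) s e : measurable_fun setT f ->
  0 < s -> 0 < e -> exists2 t : R, 0 < t & forall h, `|h| < t ->
  (mu (cube 0%R s `&` [set x | (1 < `|f (x + h) - f x|)%R]) <= e%:E)%E.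
Proof.
move=> mf s0 e0; have e30 : 0 < e / 3 by rewrite divr_gt0.
have mlt a : measurable [set x | a < f x] by exact: measurable_gt.
have mabs (a : R) : measurable [set x | a < `|f x|].
  by apply: (measurable_gt (g := fun x => `|f x|)); exact: (measurableT_comp _ mf).
pose F N := cube 0 (s + 1) `&` [set x : V | N%:R < `|f x|].
have mF N : measurable (F N) by apply: measurableI => //; exact: measurable_cube.
have [N FN] : exists N, (mu (F N) <= (e / 3)%:E)%E.
  apply: measure_small => //.
  - apply: le_lt_trans (lebesgue_cube_lty (0 : V) (_ : 0 < s + 1)); last exact: addr_gt0.
    by apply: le_measure; rewrite ?inE//; [exact: measurable_cube|exact: subIsetl].
  - move=> m n mn; apply: setIS => x /=; apply: le_lt_trans.
    by rewrite ler_nat.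
  apply/seteqP; split => // x Fx.
  have [_] := Fx (Num.bound `|f x|) I; rewrite /= ltNge => /negP; apply.
  by apply: ltW; apply: archi_boundP.
pose A i := [set x | i%:R - N%:R < f x].
have [t1 t10 Ht1] := moved_finite (2 * N)%N (fun i => mlt (i%:R - N%:R)) s0 e30.
exists (Num.min t1 1) => [|h]; first by rewrite lt_min t10 ltr01.
rewrite lt_min => /andP[ht h1].
have mm i : measurable (moved (A i) h) by apply: measurable_moved; exact: mlt.
set S := cube 0 s; pose D := \big[setU/set0]_(i < (2 * N)%N) moved (A i) h.
have mS : measurable S by exact: measurable_cube.
have mD : measurable (S `&` D) by apply: measurableI => //; exact: bigsetU_measurable.
apply: (@le_trans _ _ (mu ((S `&` D) `|` (F N `|` preshift (F N) h)))).
  apply: le_measure; rewrite ?inE.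
  - apply: measurableI => //.
    apply: (measurable_gt (g := fun x : V => `|f (x + h) - f x|)).
    apply: measurableT_comp => //; apply: measurable_funB => //.
    exact: (measurableT_comp mf (measurable_rV_shift h)).
  - by apply: measurableU => //; apply: measurableU => //; exact: measurable_preshift.
  move=> x [Sx /= fxh].
  have S1 : cube 0 (s + 1) x.
    by move: Sx; rewrite /S /cube /= => xs; apply: le_trans xs _; rewrite lerDl.
  have S2 : cube 0 (s + 1) (x + h).
    move: Sx; rewrite /S /cube /= !subr0 => xs; apply: le_trans (ler_normD _ _) _.
    by rewrite lerD// ltW.
  have [fx|fx] := ltP N%:R `|f x|; first by right; left.
  have [fh|fh] := ltP N%:R `|f (x + h)|; first by right; right.
  left; split => //; move/ler_normlP : fx => [x1 x2].
  move/ler_normlP : fh => [xh1 xh2].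
  suff : (\bigcup_(i in `I_(2 * N)%N) moved (A i) h) x by rewrite bigcup_mkord.
  have [ff|ff] := leP (f x) (f (x + h)).
    have := @Num.Theory.truncn_itv _ (f x + N%:R) ltac:(lra).
    set i := Num.truncn _; rewrite -natr1 => /andP[i1 i2].
    have ff1 : 1 < f (x + h) - f x by rewrite -(@ger0_norm _ (_ - _)) ?subr_ge0.
    exists i.+1 => /=; last first.
      by right; rewrite /A /= -natr1; split; [apply/negP; rewrite -leNgt|]; lra.
    by rewrite -(@ltr_nat R) -natr1 natrM; lra.
  have := @Num.Theory.truncn_itv _ (f (x + h) + N%:R) ltac:(lra).
  set i := Num.truncn _; rewrite -natr1 => /andP[i1 i2].
  have ff1 : 1 < f x - f (x + h).
    by rewrite -(@gtr0_norm _ (_ - _)) ?subr_gt0// distrC.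
  exists i.+1 => /=; last first.
    by left; rewrite /A /= -natr1; split; [|apply/negP; rewrite -leNgt]; lra.
  by rewrite -(@ltr_nat R) -natr1 natrM; lra.
apply: le_trans (measureU2 _ _ _) _ => //.
  by apply: measurableU => //; exact: measurable_preshift.
rewrite (_ : e = e / 3 + (e / 3 + e / 3)); last by field.
rewrite EFinD; apply: leeD; first exact: Ht1.
apply: le_trans (measureU2 _ _ _) _ => //; first exact: measurable_preshift.
by rewrite EFinD; apply: leeD => //; rewrite [leLHS](lebesgue_rV_shift h (mF N)).
Qed.
End translation_continuity.

Section gauge_limit.
Context {R : realType} {d : nat} (p : \bar R) (z : 'rV[R]_d) (s : R).
Hypotheses (p0 : (0 < p)%E) (s0 : 0 < s).
Local Notation V := 'rV[R]_d.
Local Notation mu := (lebesgue_rV R d).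
Local Notation S := (cube z s).
Implicit Types (a b : V) (f : V -> R).

Let mS : measurable S. Proof. exact: measurable_cube. Qed.

Let total r : R := \sum_(j < r.+1) 'C(r, j)%:R + 1.

Let total_gt0 r : 0 < total r.
Proof. by rewrite ltr_wpDl// sumr_ge0. Qed.

Let finite_diff_close r f y b b' (e : R) : 0 <= e ->
  (forall j, (j <= r)%N -> `|f (y + b *+ j) - f (y + b' *+ j)| <= e) ->
  `|finite_diff r b f y - finite_diff r b' f y| <= total r * e.
Proof.
move=> e0 H; rewrite /finite_diff -sumrB; apply: le_trans (ler_norm_sum _ _ _) _.
apply: (@le_trans _ _ (\sum_(j < r.+1) 'C(r, j)%:R * e)); last first.
  by rewrite -mulr_suml /total mulrDl lerDl mul1r.
apply: ler_sum => j _; rewrite -mulrBr normrM normrM normr_sign mul1r.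
by rewrite normr_nat ler_wpM2l// H// -ltnS ltn_ord.
Qed.

Let limit_sup r C f a b :
  (forall x, S x -> forall j, (j <= r)%N -> {for x + a + b *+ j, continuous f}) ->
  (forall n, 0 < n -> exists2 b', `|b' - b| < n &
    (gauge +oo S (fun x => finite_diff r b' f (x + a)) <= C%:E)%E) ->
  (gauge +oo S (fun x => finite_diff r b f (x + a)) <= C%:E)%E.
Proof.
move=> cf H.
have C0 : 0 <= C.
  by have [b' _ /(le_trans (gauge_ge0 _ _ _))] := H 1 ltr01; rewrite lee_fin.
apply/gauge_oo_le => // x Sx; rewrite leNgt; apply/negP => Cx.
set e := (`|finite_diff r b f (x + a)| - C) / (total r + 1).
have t1 : 0 < total r + 1 by rewrite addr_gt0.
have e0 : 0 < e by rewrite divr_gt0// subr_gt0.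
have near_j j : (j <= r)%N -> \forall b' \near b,
    `|f (x + a + b *+ j) - f (x + a + b' *+ j)| < e.
  move=> jr.
  have cb : (fun b' => x + a + b' *+ j) @ b --> x + a + b *+ j.
    apply: (@cvgD R V V (nbhs b)); first exact: cvg_cst.
    under eq_fun do rewrite -scaler_nat; rewrite -scaler_nat.
    by apply: (@cvgZ R V V (nbhs b) _ (fun=> j%:R) id); [exact: cvg_cst|exact: cvg_id].
  have cfj := @cvgr_dist_lt _ _ _ _ _ _ _ (cf x Sx j jr) e e0.
  exact: (cb _ (cfj _)).
have : \forall b' \near b, forall j : 'I_r.+1,
    `|f (x + a + b *+ j) - f (x + a + b' *+ j)| < e.
  apply: (@filter_forall _ _ (fun (j : 'I_r.+1) b' =>
    `|f (x + a + b *+ j) - f (x + a + b' *+ j)| < e) (nbhs b)) => j.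
  by apply: near_j; rewrite -ltnS ltn_ord.
move=> /nbhs_ballP[n /= n0 nH].
have [b' bb' /gauge_oo_le] := H n n0; move=> /(_ C0 x Sx) Cb'.
have Hb : forall j : 'I_r.+1, `|f (x + a + b *+ j) - f (x + a + b' *+ j)| < e.
  by apply: nH; rewrite mx_norm_ball /ball_ /= distrC.
have := @finite_diff_close r f (x + a) b b' e (ltW e0) _.
move=> /(_ (fun j jr => ltW (Hb (Ordinal (jr : (j < r.+1)%N))))).
set F := finite_diff r b f (x + a) in e e0 Hb nH near_j Cx *.
set F' := finite_diff r b' f (x + a) in Cb' *.
have : `|F| <= `|F - F'| + `|F'| by rewrite -[X in `|X| <= _](subrK F') ler_normD.
have : (total r + 1) * e = `|F| - C by rewrite mulrC divfK// gt_eqF.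
rewrite mulrDl mul1r.
set FF := `|F - F'|; set nF := `|F|; set nF' := `|F'| in Cb' *.
move: (total r * e) => te; lra.
Qed.

Let limit_Lp r (q : R) C : 0 < q -> exists K, forall f a b, adm q%:E f ->
  (forall n, 0 < n -> exists2 b', `|b' - b| < n &
    (gauge q%:E S (fun x => finite_diff r b' f (x + a)) <= C%:E)%E) ->
  (gauge q%:E S (fun x => finite_diff r b f (x + a)) <= K%:E)%E.
Proof.
move=> q0.
have q0' : (0 < q%:E)%E by rewrite lte_fin.
have [K1 HK1] := gauge_cube_bounded z q0' s0 (ltW (total_gt0 r)).
have [K2 HK2] := gaugeD (d := d) C K1 q0'.
exists (K2 + 1) => f a b mf H.
set F := fun x => finite_diff r b f (x + a).
have mF : adm q%:E F by apply: adm_shift; rewrite finite_diffE; exact: adm_mdiff.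
have mg W : measurable W -> measurable_fun W (fun x => (`|F x| `^ q)%:E).
  exact: measurable_powR_norm.
pose W (M : nat) := S `&` [set x | `|F x| `^ q <= M%:R].
have mW M : measurable (W M).
  apply: measurableI => //.
  have mg' : measurable_fun setT (fun x => `|F x| `^ q).
    by apply/measurable_EFinP; exact: mg.
  have -> : [set x | `|F x| `^ q <= M%:R] = (fun x => `|F x| `^ q) @^-1` [set` `]-oo, M%:R]].
    by apply/seteqP; split => x; rewrite /= in_itv.
  by rewrite -[X in measurable X]setTI; exact: mg'.
have WK M : (\int[mu]_(x in W M) (`|F x| `^ q)%:E <= (K2 + 1)%:E)%E.
  pose e : R := (M.+1%:R * r.+1%:R)^-1.
  have e0 : 0 < e by rewrite invr_gt0 mulr_gt0.
  pose big := `|z| + s + `|a| + `|b| *+ r.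
  have big0 : 0 < big by rewrite /big ltr_pwDl ?mulrn_wge0// ltr_pwDl// ltr_wpDl.
  have [n n0 Hn] := translation_continuous mf big0 e0.
  have [b' bb' Cb'] := H (n / r.+1%:R) (divr_gt0 n0 (ltr0Sn _ _)).
  pose B j := [set x | 1 < `|f (x + a + b' *+ j) - f (x + a + b *+ j)|].
  pose Bad := \big[setU/set0]_(j < r.+1) (S `&` B j).
  have mB j : measurable (B j).
    apply: (measurable_gt (g := fun x : V => `|f (x + a + b' *+ j) - f (x + a + b *+ j)|)).
    apply: measurableT_comp => //; apply: measurable_funB => //.
      under eq_fun do rewrite -addrA; exact: (@adm_shift _ _ q%:E).
    under eq_fun do rewrite -addrA; exact: (@adm_shift _ _ q%:E).
  have mBad : measurable Bad by apply: bigsetU_measurable => j _; exact: measurableI.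
  have Bj j : (j < r.+1)%N -> (mu (S `&` B j) <= e%:E)%E.
    move=> jr; have hj : `|(b' - b) *+ j| < n.
      rewrite -scaler_nat normrZ normr_nat.
      apply: (@le_lt_trans _ _ (r.+1%:R * `|b' - b|)).
        by rewrite ler_wpM2r// ler_nat ltnW.
      by rewrite mulrC -ltr_pdivlMr.
    apply: le_trans (Hn _ hj).
    set G := (X in (_ <= mu X)%E).
    have mG : measurable G.
      apply: measurableI; first exact: measurable_cube.
      apply: (measurable_gt (g := fun x : V => `|f (x + (b' - b) *+ j) - f x|)).
      apply: measurableT_comp => //; apply: measurable_funB => //.
      exact: (@adm_shift _ _ q%:E).
    rewrite -[leRHS](lebesgue_rV_shift (a + b *+ j) mG); apply: le_measure; rewrite ?inE.
    - by apply: measurableI.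
    - exact: measurable_preimage_shift.
    move=> x [Sx Bx]; split => /=.
      rewrite /cube /= subr0 addrA; apply: le_trans (ler_normD _ _) _.
      apply: lerD; last first.
        rewrite -scaler_nat normrZ normr_nat -[leRHS]mulr_natl ler_wpM2r// ler_nat.
        by rewrite -ltnS.
      apply: le_trans (ler_normD _ _) _; rewrite lerD2r.
      by rewrite -[x](subrK z) addrC; apply: le_trans (ler_normD _ _) _; rewrite lerD2l.
    move: Bx; rewrite /B /= mulrnBl.
    rewrite !addrA (_ : x + a + b *+ j + b' *+ j - b *+ j = x + a + b' *+ j)//.
    by rewrite -!addrA; congr (_ + (_ + _)); rewrite addrCA subrr addr0.
  have mBadle : (mu Bad <= (M.+1%:R^-1)%:E)%E.
    have mSB j : (j < r.+1)%N -> measurable (S `&` B j) by move=> _; exact: measurableI.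
    apply: le_trans (Boole_inequality mu mSB) _.
    apply: (@le_trans _ _ (\sum_(j < r.+1) e%:E)%E).
      by apply: lee_sum => j _; exact: Bj.
    rewrite sumEFin lee_fin sumr_const card_ord /e invfM -[leLHS]mulr_natr mulfVK//.
  pose A := S `\` Bad.
  have mA : measurable A by exact: measurableD.
  pose F' := fun x => finite_diff r b' f (x + a).
  have mF' : adm q%:E F' by apply: adm_shift; rewrite finite_diffE; exact: adm_mdiff.
  have AK : (gauge q%:E A F <= K2%:E)%E.
    pose G := (F \- F') \_ A.
    have mG : adm q%:E G.
      have mFF : measurable_fun setT (F \- F' : V -> R) by exact: (@admB _ _ q%:E).
      apply/(measurable_restrictT _ _).1 => //.
      exact: (measurable_funS measurableT _ mFF).
    rewrite (@gauge_eq _ _ q%:E A F (F' \+ G)); last first.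
      by move=> x xA; rewrite /G /patch /= xA /= addrC subrK.
    apply: HK2 => //.
      by apply: le_trans Cb'; apply: gauge_subset => //; exact: subDsetl.
    apply: (@le_trans _ _ (gauge q%:E S G)).
      by apply: gauge_subset => //; exact: subDsetl.
    apply: HK1 => // x Sx; rewrite /G /patch; case: ifPn; last first.
      by rewrite normr0 => _; exact/ltW.
    rewrite inE => -[_ nBad]; rewrite -[leRHS]mulr1; apply: finite_diff_close => // j jr.
    rewrite leNgt distrC; apply/negP => Bx; apply: nBad.
    suff : (\bigcup_(i in `I_r.+1) (S `&` B i)) x by rewrite bigcup_mkord.
    by exists j.
  have BK : (\int[mu]_(x in W M `&` Bad) (`|F x| `^ q)%:E <= 1%:E)%E.
    have mWB : measurable (W M `&` Bad) by exact: measurableI.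
    apply: (@le_trans _ _ (\int[mu]_(x in W M `&` Bad) cst (M%:R)%:E x)%E).
      apply: ge0_le_integral => //; first exact: mg.
      by move=> x [[_ xM] _].
    rewrite integral_cst//.
    apply: (@le_trans _ _ (M%:R%:E * (M.+1%:R^-1)%:E)%E).
      apply: lee_wpmul2l => //; apply: le_trans mBadle.
      by apply: (le_measure mu); rewrite ?inE//; exact: subIsetr.
    by rewrite -EFinM lee_fin ler_pdivrMr// mul1r ler_nat.
  apply: (@le_trans _ _ (gauge q%:E (A `|` (W M `&` Bad)) F)).
    apply: ge0_subset_integral => //.
    - by apply: measurableU => //; exact: measurableI.
    - by apply: mg; apply: measurableU => //; exact: measurableI.
    - move=> x Wx; have [xB|xB] := pselect (Bad x); first by right.
      by left; split=> //; case: Wx.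
  rewrite EFinD; apply: le_trans (gauge_setU _ _ _) _ => //; first exact: measurableI.
  exact: leeD.
have -> : gauge q%:E S F = (\int[mu]_(x in \bigcup_M W M) (`|F x| `^ q)%:E)%E.
  rewrite /gauge (_ : \bigcup_M W M = S)//; apply/seteqP; split => [x [M _ []]//|x Sx].
  exists (Num.bound (`|F x| `^ q)) => //; split => //=.
  by apply: ltW; apply: archi_boundP; exact: powR_ge0.
have ndW : {homo W : m n / (m <= n)%N >-> (m <= n)%O}.
  move=> m n mn; apply/subsetPset => x [Sx xm]; split => //; apply: le_trans xm _.
  by rewrite ler_nat.
have f0 i x : W i x -> (0 <= (`|F x| `^ q)%:E)%E by rewrite lee_fin powR_ge0.
have cv := ge0_nondecreasing_set_cvg_integral (mu := mu) ndW mW (fun i => mg _ (mW i)) f0.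
rewrite -(cvg_lim _ cv)//; apply: lime_le.
  by apply/cvg_ex; eexists; exact: cv.
by near=> M; exact: WK.
Unshelve. all: by end_near.
Qed.

Lemma gauge_diff_limit r C : exists K, forall f a b, adm p f ->
  (p = +oo%E -> forall x, S x -> forall j, (j <= r)%N ->
    {for x + a + b *+ j, continuous f}) ->
  (forall n, 0 < n -> exists2 b', `|b' - b| < n &
    (gauge p S (fun x => finite_diff r b' f (x + a)) <= C%:E)%E) ->
  (gauge p S (fun x => finite_diff r b f (x + a)) <= K%:E)%E.
Proof.
case: p p0 => [q| |]// q0.
  have [|K HK] := @limit_Lp r q C; first by rewrite -lte_fin.
  by exists K => f a b af _; exact: HK.
by exists C => f a b _ cf; apply: limit_sup; exact: cf.
Qed.
End gauge_limit.

(** * Convex bodies and directions *)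

Section euclidean_norm.
Context {R : realType} {d : nat}.
Local Notation V := 'rV[R]_d.
Implicit Types (x y h : V) (E Omega : set V).

Lemma enormZ (a : R) x : enorm (a *: x) = `|a| * enorm x.
Proof.
rewrite /enorm; under eq_bigr do rewrite mxE exprMn.
by rewrite -mulr_sumr sqrtrM ?sqr_ge0// sqrtr_sqr.
Qed.

Lemma enormN x : enorm (- x) = enorm x.
Proof. by rewrite -scaleN1r enormZ normrN1 mul1r. Qed.

Lemma enorm_gt0 x : x != 0 -> 0 < enorm x.
Proof.
move=> x0; rewrite sqrtr_gt0 lt_neqAle sumr_ge0 ?andbT; last by move=> i _; exact: sqr_ge0.
apply: contraNneq x0 => /esym/eqP.
rewrite psumr_eq0 => [/allP x0|i _]; last exact: sqr_ge0.
apply/eqP/rowP => i; rewrite mxE; apply/eqP.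
by have := x0 i (mem_index_enum i); rewrite sqrf_eq0.
Qed.

Lemma enorm_bounded (M : R) : exists K, forall x, `|x| <= M -> enorm x <= K.
Proof.
exists (Num.sqrt (\sum_(i < d) M ^+ 2)) => x xM.
have M0 : 0 <= M by apply: le_trans xM.
rewrite /enorm ler_wsqrtr// ler_sum// => i _.
rewrite -real_normK ?num_real// ler_pXn2r ?nnegrE//.
by move/(rV_norm_le _ M0) : xM.
Qed.

Lemma enorm_continuous : continuous (@enorm R d).
Proof.
move=> x; apply: (@continuous_comp _ _ _ (fun x : V => \sum_i x ord0 i ^+ 2) Num.sqrt);
  last exact: sqrt_continuous.
suff H (r : seq 'I_d) : continuous (fun x : V => \sum_(i <- r) x ord0 i ^+ 2) by exact: H.
elim: r => [|i r IH] {}x.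
  by under eq_fun do rewrite big_nil; exact: cst_continuous.
under eq_fun do rewrite big_cons expr2.
apply: (@cvgD R R^o V (nbhs x)); last exact: IH.
by apply: (@cvgM _ _ (nbhs x)); exact: coord_continuous.
Qed.

Lemma enorm_le_diam Omega x y : bounded_set Omega -> Omega x -> Omega y ->
  enorm (x - y) <= diam Omega.
Proof.
move=> [M [Mr OM]] Ox Oy; apply: ub_le_sup; last by exists x => //; exists y.
have [K HK] := enorm_bounded (2 * (M + 1)).
have OM1 u : Omega u -> `|u| <= M + 1 by move=> Ou; apply: (OM (M + 1)); rewrite ?ltrDl.
exists K => _ [u Ou [v Ov <-]]; apply: HK; apply: le_trans (ler_normB _ _) _.
by have := OM1 u Ou; have := OM1 v Ov; lra.
Qed.

Lemma dense_directions E h (n : R) :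
  closure (E `|` [set - x | x in E]) = sphere -> (0 < d)%N -> 0 < n ->
  exists u xi, E xi /\ `|u *: xi - h| < n.
Proof.
move=> Esphere d0 n0.
have near xi e : enorm xi = 1 -> 0 < e -> exists (b : bool) x, E x /\
    `|(-1) ^+ b *: x - xi| < e.
  move=> x1 e0; have : closure (E `|` [set - x | x in E]) xi by rewrite Esphere.
  move=> /(_ (ball xi e) (nbhsx_ballx _ _ e0)) [w [Ew xw]].
  have {}xw : `|w - xi| < e by move: xw; rewrite mx_norm_ball /ball_ /= distrC.
  case: Ew xw => [Ew|[y Ey <-]] xw.
    by exists false, w; rewrite expr0 scale1r.
  by exists true, y; rewrite expr1 scaleN1r.
have [->|h0] := eqVneq h 0.
  pose e0 : V := delta_mx ord0 (Ordinal d0).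
  have e01 : enorm e0 = 1.
    rewrite /enorm (bigD1 (Ordinal d0))//= big1 ?addr0 => [|i i0].
      by rewrite mxE !eqxx expr1n sqrtr1.
    by rewrite mxE (negbTE i0) andbF expr0n.
  have [_ [x [Ex _]]] := near e0 1 e01 ltr01.
  by exists 0, x; rewrite scale0r subr0 normr0.
have hn := enorm_gt0 h0.
have h1 : enorm ((enorm h)^-1 *: h) = 1.
  by rewrite enormZ ger0_norm ?invr_ge0 ?ltW// mulVf// gt_eqF.
have [b [x [Ex xh]]] := near _ (n / enorm h) h1 (divr_gt0 n0 hn).
exists (enorm h * (-1) ^+ b), x; split => //.
have -> : (enorm h * (-1) ^+ b) *: x - h =
    enorm h *: ((-1) ^+ b *: x - (enorm h)^-1 *: h).
  by rewrite scalerBr !scalerA mulfV ?gt_eqF// scale1r.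
by rewrite normrZ gtr0_norm// mulrC -ltr_pdivlMr.
Qed.
End euclidean_norm.

Section convex_sets.
Context {R : realType} {d : nat}.
Local Notation V := 'rV[R]_d.
Implicit Types (x y h : V) (Omega : set V).

Lemma convex_segment Omega x y (t : R) : convex_set Omega -> Omega x -> Omega y ->
  0 <= t <= 1 -> Omega (y + t *: (x - y)).
Proof.
move=> cO Ox Oy t01.
have := cO x y (Itv01 (andP t01).1 (andP t01).2); rewrite !inE => /(_ Ox Oy).
congr Omega.
change (t *: x + (1 - t) *: y = y + t *: (x - y)).
by rewrite scalerBl scale1r scalerBr addrCA.
Qed.

Lemma convex_cube Omega c x (s t : R) : convex_set Omega -> cube c s `<=` Omega ->
  Omega x -> 0 <= t < 1 -> cube (c + t *: (x - c)) ((1 - t) * s) `<=` Omega.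
Proof.
move=> cO cs Ox /andP[t0 t1] y ys.
have t1' : 0 < 1 - t by rewrite subr_gt0.
pose w := (1 - t)^-1 *: (y - t *: x).
have -> : y = w + t *: (x - w).
  rewrite scalerBr addrCA -{1}[w]scale1r -scalerBl scalerA divff ?gt_eqF// scale1r.
  by rewrite addrC subrK.
apply: convex_segment => //; last by rewrite t0 ltW.
apply: cs; rewrite /cube /=.
have -> : w - c = (1 - t)^-1 *: (y - (c + t *: (x - c))).
  by apply/rowP => i; rewrite !mxE; field; exact: lt0r_neq0.
rewrite normrZ gtr0_norm ?invr_gt0// mulrC ler_pdivrMr// mulrC.
exact: ys.
Qed.
End convex_sets.

Section Lp_gauge.
Context {R : realType} {d : nat}.
Local Notation V := 'rV[R]_d.
Implicit Types (A : set V) (f : V -> R) (p : \bar R).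

Lemma gauge_le_Lp_norm p A f : (0 < p)%E -> (Lp_norm A p f <= 1)%E ->
  (gauge p A f <= 1)%E.
Proof.
case: p => [q| |]//= q0; set I := (\int[_]_(x in _) _)%E => I1.
have {}q0 : 0 < q by rewrite -lte_fin.
have I0 : (0 <= I)%E by apply: integral_ge0 => x _; rewrite lee_fin powR_ge0.
have : ((I `^ q^-1) `^ q <= 1 `^ q)%E.
  apply: gt0_ler_poweR => //; first exact: ltW.
  - by rewrite in_itv/= leey poweR_ge0.
  - by rewrite in_itv/= leey lee_fin ler01.
by rewrite poweR1r -poweRrM mulVf ?gt_eqF// poweRe1.
Qed.

Lemma Lp_norm_le_gauge p (C : R) : (0 < p)%E -> exists2 K : \bar R, (K < +oo)%E &
  forall A f, (gauge p A f <= C%:E)%E -> (Lp_norm A p f <= K)%E.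
Proof.
case: p => [q| |]//= q0; last by exists C%:E => //; rewrite ltry.
have {}q0 : 0 < q by rewrite -lte_fin.
exists (C%:E `^ q^-1)%E => [|A f fC]; first by rewrite poweR_lty// ltry.
have I0 := gauge_ge0 q%:E A f.
apply: gt0_ler_poweR => //.
- by rewrite invr_ge0 ltW.
- by rewrite in_itv/= leey andbT.
- by rewrite in_itv/= leey andbT; exact: le_trans fC.
Qed.

Lemma Lp_gauge_lty p A f : (0 < p)%E -> compact A -> Lp A p f ->
  (gauge p A f < +oo)%E.
Proof.
case: p => [q| |]//= q0; rewrite /Lp /=.
  move=> _ [_]; apply: contraTT; rewrite -!leNgt !leye_eq => /eqP ->.
  by rewrite poweRyr// invr_eq0 gt_eqF// -lte_fin.
move=> cA cf.
have clA : closure A = A.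
  by apply/esym/closure_id; apply: compact_closed => //; exact: norm_hausdorff.
have {}cf : {within A, continuous f} by move: cf => /=; rewrite clA.
have /(@compact_bounded R R^o) [M [Mr fM]] : compact (f @` A).
  exact: continuous_compact.
have M1 x : A x -> `|f x| <= `|M| + 1.
  by move=> Ax; apply: (fM (`|M| + 1)); [rewrite ltr_pwDr// ler_norm|exists x].
apply: le_lt_trans (ltry (`|M| + 1)).
by have /gauge_oo_le := M1; apply; rewrite addr_ge0.
Qed.
End Lp_gauge.

Section whitney_finite.
Context {R : realType} {d : nat} (E Omega : set 'rV[R]_d) (r : nat) (p : \bar R).
Hypotheses (d0 : (0 < d)%N) (p0 : (0 < p)%E) (r0 : (0 < r)%N).
Hypotheses (hE : E `<=` sphere) (Es : closure (E `|` [set - x | x in E]) = sphere).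
Hypothesis bodyO : convex_body Omega.
Local Notation V := 'rV[R]_d.
Implicit Types (x y a b h : V) (f Q : V -> R) (s t : R).

Let compO : compact Omega. Proof. by case: bodyO. Qed.
Let convO : convex_set Omega. Proof. by case: bodyO. Qed.
Let closO : closed Omega.
Proof. by apply: compact_closed => //; exact: norm_hausdorff. Qed.
Let measO : measurable Omega. Proof. exact: measurable_closed. Qed.

Let admissible f := Lp Omega p f /\ (dir_modulus r E f Omega p <= 1)%E.

Let adm_restrict f : Lp Omega p f -> adm p (f \_ Omega).
Proof.
case: p p0 => [q| |]// q0; rewrite /Lp /= => -[mf _].
exact/(measurable_restrictT _ _).1.
Qed.

Let gauge_set0 F : gauge p (set0 : set V) F = 0%E.
Proof.
case: p p0 => [q| |]// _ /=; first by rewrite integral_set0.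
by rewrite image_set0 setU0 ereal_sup1.
Qed.

Let measurable_diff_dom h : measurable (diff_dom Omega r h).
Proof.
have -> : diff_dom Omega r h = \bigcap_(j in [set j | (j <= r)%N])
    ((fun x => x + h *+ j) @^-1` Omega).
  by apply/seteqP; split => x H j /H.
apply: bigcap_measurable => [|j _]; first by exists 0%N.
exact: measurable_preimage_shift.
Qed.

Let restrictE f x : Omega x -> (f \_ Omega) x = f x.
Proof. by move=> Ox; rewrite /patch mem_set. Qed.

Let gauge_direction f u xi : admissible f -> E xi ->
  (gauge p (diff_dom Omega r (u *: xi)) (finite_diff r (u *: xi) (f \_ Omega)) <= 1)%E.
Proof.
move=> [Lf fE] Exi; set h := u *: xi.
have [->|/set0P[x Dx]] := eqVneq (diff_dom Omega r h) set0.
  by rewrite gauge_set0.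
have uO : `|u| <= diam Omega.
  have -> : `|u| = enorm (x + h *+ 1 - (x + h *+ 0)).
    by rewrite mulr1n mulr0n addr0 addrAC subrr add0r enormZ (hE Exi) mulr1.
  by apply: enorm_le_diam; [exact: compact_bounded|exact: Dx|exact: Dx].
rewrite (@gauge_eq _ _ p _ _ (finite_diff r h f)); last first.
  move=> y; rewrite inE => Dy; rewrite /finite_diff; apply: eq_bigr => j _.
  by rewrite restrictE//; apply: Dy; rewrite -ltnS.
apply: gauge_le_Lp_norm => //; apply: le_trans fE.
apply: (@le_trans _ _ (modulus r xi f (diam Omega) Omega p)).
  by apply: ereal_sup_ubound; exists u.
by apply: ereal_sup_ubound; exists xi.
Qed.

Let cube_shift c s t a : `|a| <= t -> cube c s `<=` (fun x => x + a) @^-1` cube c (s + t).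
Proof.
move=> a_t x; rewrite /cube /= => xs; rewrite addrAC.
by apply: le_trans (ler_normD _ _) _; exact: lerD.
Qed.

Let gauge_cube_shift F c s t a (C : R) : adm p F -> `|a| <= t ->
  (gauge p (cube c (s + t)) F <= C%:E)%E ->
  (gauge p (cube c s) (fun x => F (x + a))%R <= C%:E)%E.
Proof.
move=> aF a_t FC; apply: le_trans FC.
rewrite -[leRHS](gauge_shift a (measurable_cube _ _) aF).
apply: gauge_subset; last exact: cube_shift.
- exact: measurable_cube.
- by apply: measurable_preimage_shift; exact: measurable_cube.
- exact: adm_shift.
Qed.

Let mdiff_lty F c s t (C : R) n : adm p F -> 
  (gauge p (cube c (s + n%:R * t)) F <= C%:E)%E ->
  exists M, forall hs, size hs = n -> all (fun h : V => `|h| <= t) hs ->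
    (gauge p (cube c s) (mdiff hs F) <= M%:E)%E.
Proof.
move=> aF; elim: n s => [|n IH] s.
  by rewrite mul0r addr0 => FC; exists C; case.
rewrite -natr1 mulrDl mul1r addrA addrAC => /IH[M HM].
have [K HK] := gaugeB (d := d) M M p0.
exists K; case=> [//|h hs] [hn] /= /andP[ht hst].
have ah := adm_mdiff hs aF.
apply: (HK (cube c s) (fun x => mdiff hs F (x + h)) (mdiff hs F)) => //.
- exact: measurable_cube.
- exact: adm_shift.
- by apply: gauge_cube_shift ht _ => //; exact: HM.
- apply: le_trans (HM _ hn hst); apply: gauge_subset => //; try exact: measurable_cube.
  move=> x; rewrite /cube /= => xs; apply: le_trans xs _.
  by rewrite lerDl; apply: le_trans ht.
Qed.

Let local_approx c s0 : 0 < s0 -> cube c s0 `<=` Omega ->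
  exists2 s, 0 < s /\ cube c s `<=` Omega & exists C, forall f, admissible f ->
  exists2 Q, polydeg r.-1 Q & (gauge p (cube c s) (f \_ Omega \- Q)%R <= C%:E)%E.
Proof.
move=> s00 cO; pose k : R := 2 * (1 + 2 * r%:R + 2 * (r%:R * r%:R)).
have rr : 0 <= r%:R :> R by [].
have rr2 : 0 <= r%:R * r%:R :> R by rewrite mulr_ge0.
have k0 : 0 < k by rewrite /k; lra.
pose s := s0 / k.
have s_gt0 : 0 < s by rewrite divr_gt0.
have sk : s0 = s * k by rewrite /s divfK// gt_eqF.
have ss0 : s <= s0 by rewrite sk ler_peMr// ?ltW// /k; lra.
exists s.
  split => // x; rewrite /cube /= => xs; apply: cO; exact: le_trans ss0.
have [K1 HK1] := gauge_diff_limit c p0 s_gt0 r 1.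
have [K2 HK2] := gauge_mdiff_bound c p0 s_gt0 r K1.
have [K3 HK3] := polydeg_approx c p0 s_gt0 r.-1 K2.
exists K3 => f af; have aF := adm_restrict af.1.
have inO x a b n : cube c s x -> `|a| <= r%:R * (2 * s) ->
    `|b| <= r%:R * (2 * s) + s / r.+1%:R -> (n <= r)%N -> `|x + a + b *+ n - c| < s0.
  move=> xs ar br nr.
  have -> : x + a + b *+ n - c = (x - c) + a + b *+ n by rewrite addrAC (addrAC x).
  apply: le_lt_trans (ler_normD _ _) _.
  apply: (@le_lt_trans _ _ ((s + r%:R * (2 * s)) + (r%:R * (r%:R * (2 * s)) + s))).
    apply: lerD; first by apply: le_trans (ler_normD _ _) _; exact: lerD.
    rewrite -scaler_nat normrZ normr_nat.
    apply: (@le_trans _ _ (r%:R * (r%:R * (2 * s) + s / r.+1%:R))).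
      by rewrite ler_pM// ler_nat.
    rewrite mulrDr lerD2l mulrCA; apply: ler_piMr; first exact: ltW.
    by rewrite ler_pdivrMr// mul1r ler_nat.
  rewrite sk /k.
  have -> : s + r%:R * (2 * s) + (r%:R * (r%:R * (2 * s)) + s) =
    s * (2 + 2 * r%:R + 2 * (r%:R * r%:R)) by ring.
  by rewrite ltr_pM2l//; have : 0 < r%:R :> R; [rewrite ltr0n|lra].
have [M0 HM0] : exists M : R, (gauge p Omega (f \_ Omega) <= M%:E)%E.
  have := Lp_gauge_lty p0 compO af.1.
  rewrite -(@gauge_eq _ _ p Omega (f \_ Omega)); last first.
    by move=> x; rewrite inE; exact: restrictE.
  move: (gauge_ge0 p Omega (f \_ Omega)); case: gauge => // M _ _.
  by exists M.
have sub t : t <= s0 -> (gauge p (cube c t) (f \_ Omega) <= M0%:E)%E.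
  move=> ts; apply: le_trans HM0; apply: gauge_subset => //.
    exact: measurable_cube.
  by move=> x xt; apply: cO; apply: le_trans xt ts.
have [||Q Qr fQ] := HK3 (f \_ Omega) aF; last by exists Q.
  move=> hs; rewrite prednK// => hsr hsH.
  apply: (HK2 (f \_ Omega)) => // a b ar br.
  apply: HK1 => // [pE x xs j jr|n n0].
    have xO : Omega° (x + a + b *+ j).
      have := inO x a b j xs ar _ jr; rewrite (le_trans br) ?lerDl ?divr_ge0 ?ltW//.
      move=> /(_ isT) xcs.
      have e0 : 0 < s0 - `|x + a + b *+ j - c| by rewrite subr_gt0.
      apply/nbhs_ballP; exists (s0 - `|x + a + b *+ j - c|) => // y.
      rewrite mx_norm_ball /ball_ /= distrC => xy; apply: cO; rewrite /cube /=.
      rewrite -(subrK (x + a + b *+ j) y) -addrA.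
      by apply: le_trans (ler_normD _ _) _; rewrite -lerBrDr ltW.
    have := af.1; rewrite /Lp pE eqxx /=.
    have clO : closure Omega = Omega by apply/esym/closure_id.
    rewrite clO => /(continuous_subspaceW (@interior_subset _ Omega)).
    rewrite continuous_open_subspace; last exact: open_interior.
    move=> /(_ _ (mem_set xO)) fc.
    set y0 := x + a + b *+ j in xO fc *.
    suff : (f \_ Omega) y @[y --> y0] --> f y0.
      by rewrite -(restrictE f (interior_subset xO)).
    apply: cvg_trans fc; apply: (@near_eq_cvg _ _ (nbhs y0)).
    have : nbhs y0 Omega := xO.
    by apply: filterS => y Oy; rewrite restrictE.
  pose n' := Num.min n (s / r.+1%:R).
  have n'0 : 0 < n' by rewrite lt_min n0 divr_gt0.
  have [u [xi [Exi uxi]]] := dense_directions b Es d0 n'0.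
  exists (u *: xi); first by apply: lt_le_trans uxi _; rewrite ge_min lexx.
  have ub : `|u *: xi| <= r%:R * (2 * s) + s / r.+1%:R.
    rewrite -(subrK b (u *: xi)) addrC; apply: le_trans (ler_normD _ _) _.
    apply: lerD => //; rewrite -normrN opprB.
    by apply: ltW; rewrite distrC; apply: lt_le_trans uxi _; rewrite ge_min lexx orbT.
  apply: le_trans (gauge_direction u af Exi).
  have aFd : adm p (finite_diff r (u *: xi) (f \_ Omega)).
    by rewrite finite_diffE; exact: adm_mdiff.
  rewrite -[leRHS](gauge_shift a (measurable_diff_dom _) aFd).
  apply: gauge_subset.
  - exact: measurable_cube.
  - exact: measurable_preimage_shift.
  - exact: adm_shift.
  - move=> x xs j jr; apply: cO; apply: ltW; exact: inO.
move=> n nr; apply: (mdiff_lty aF (C := M0)); apply: sub.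
rewrite sk /k.
have : n%:R * (2 * s) <= r%:R * (2 * s).
  apply: ler_wpM2r; first by rewrite mulr_ge0// ltW.
  by rewrite ler_nat (leq_trans nr)// leq_pred.
have : 0 <= s * (r%:R * r%:R) by rewrite mulr_ge0// ltW.
have : 0 <= s * r%:R by rewrite mulr_ge0// ltW.
nra.
Qed.

(* A point near which every f is controlled by the polynomial Q attached to it
   by P, with a constant that depends neither on f nor on Q. *)
Let good (P : (V -> R) -> (V -> R) -> Prop) x := exists e, 0 < e /\ exists C,
  forall f Q, P f Q ->
  (gauge p (cube x e `&` Omega) (f \_ Omega \- Q)%R <= C%:E)%E.

Let good_step (P : (V -> R) -> (V -> R) -> Prop) x h0 :
  (forall f Q, P f Q -> admissible f /\ polydeg r.-1 Q) ->
  (forall j, (0 < j <= r)%N -> good P (x + h0 *+ j) /\ Omega° (x + h0 *+ j)) ->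
  good P x.
Proof.
move=> PP xg.
have /choice[e He] (i : 'I_r) : exists e, 0 < e /\ cube (x + h0 *+ i.+1) e `<=` Omega /\
    exists C, forall f Q, P f Q ->
    (gauge p (cube (x + h0 *+ i.+1) e) (f \_ Omega \- Q)%R <= C%:E)%E.
  have [|[e1 [e10 [C HC]]] /nbhs_ballP[e2 /= e20 O2]] := xg i.+1; first exact: ltn_ord.
  have e22 : 0 < e2 / 2 by rewrite divr_gt0.
  exists (Num.min e1 (e2 / 2)); split; first by rewrite lt_min e10.
  have cO : cube (x + h0 *+ i.+1) (Num.min e1 (e2 / 2)) `<=` Omega.
    move=> y; rewrite /cube /= le_min => /andP[_ ye]; apply: O2.
    rewrite mx_norm_ball /ball_ /= distrC; apply: le_lt_trans ye _.
    by rewrite ltr_pdivrMr// ltr_pMr// ltr1n.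
  split=> //; exists C => f Q fQ; apply: le_trans (HC f Q fQ).
  have [af Qr] := PP _ _ fQ.
  apply: gauge_subset.
  - exact: measurable_cube.
  - by apply: measurableI => //; exact: measurable_cube.
  - by apply: admB; [exact: adm_restrict af.1|exact: adm_polydeg Qr].
  - move=> y yc; split; last exact: cO.
    by move: yc; rewrite /cube /= le_min => /andP[].
have /choice[C HC] i := (He i).2.2.
pose e0 := (\sum_i (e i)^-1 + 1)^-1.
have ei i : 0 < (e i)^-1 by rewrite invr_gt0; case: (He i).
have S0 : 0 <= \sum_i (e i)^-1 by apply: sumr_ge0 => i _; exact/ltW.
have e00 : 0 < e0 by rewrite invr_gt0; lra.
have e0e i : e0 <= e i.
  rewrite -[leRHS]invrK lef_pV2 ?posrE//; last lra.
  rewrite (bigD1 i)//= -addrA lerDl addr_ge0// sumr_ge0// => k _; exact/ltW.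
have n0 : 0 < e0 / (2 * r.+1%:R) by rewrite divr_gt0// mulr_gt0.
have [u [xi [Exi uxi]]] := dense_directions h0 Es d0 n0.
set h := u *: xi in uxi.
pose k (i : 'I_r) : R := (-1) ^+ (r + i.+1) * 'C(r, i.+1)%:R.
have /choice[K1 HK1] i := gaugeZ_le (d := d) (k i) (C i) p0.
have [K2 HK2] := gauge_sum (d := d) (index_enum 'I_r) K1 p0.
have [K3 HK3] := gaugeB (d := d) 1 K2 p0.
have [K4 HK4] := gaugeZ_le (d := d) ((-1) ^+ r) K3 p0.
exists (e0 / 2); split; first by rewrite divr_gt0.
exists K4 => f Q fQ; have [af Qr] := PP _ _ fQ.
set U := cube x (e0 / 2) `&` Omega.
have mU : measurable U by apply: measurableI => //; exact: measurable_cube.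
pose g := f \_ Omega \- Q.
have aF := adm_restrict af.1.
have ag : adm p g by apply: admB => //; exact: adm_polydeg Qr.
have inc y (i : 'I_r) : U y -> cube (x + h0 *+ i.+1) (e i) (y + h *+ i.+1).
  move=> [yx _]; apply: le_trans (e0e i).
  have -> : y + h *+ i.+1 - (x + h0 *+ i.+1) = (y - x) + (h - h0) *+ i.+1.
    by rewrite mulrnBl opprD addrACA.
  apply: le_trans (ler_normD _ _) _; rewrite [leRHS]splitr; apply: lerD => //.
  rewrite -scaler_nat normrZ normr_nat.
  apply: (@le_trans _ _ (r.+1%:R * (e0 / (2 * r.+1%:R)))).
    by apply: ler_pM => //; [rewrite ler_nat ltnW// ltnS|exact: ltW].
  by rewrite mulrC invfM mulrA divfK ?pnatr_eq0.
have UD : U `<=` diff_dom Omega r h.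
  move=> y Uy [|j] jr; first by rewrite mulr0n addr0; case: Uy.
  by apply: (He (Ordinal jr)).2.1; exact: (inc y (Ordinal jr)).
rewrite -/g (_ : g = (-1) ^+ r \*o (finite_diff r h (f \_ Omega) \-
    (fun y => \sum_i (k i \*o (fun y => g (y + h *+ i.+1))) y))); last first.
  have : finite_diff r h g = finite_diff r h (f \_ Omega).
    rewrite !finite_diffE mdiffB (mdiff_polydeg0 Qr) ?size_nseq ?prednK//.
    by apply/funext => y /=; rewrite subr0.
  move=> gE; apply/funext => y /=; rewrite -gE /finite_diff big_ord_recl /=.
  rewrite addn0 bin0 mulr0n addr0 addrK mulr1 mulrA -expr2 sqrr_sign mul1r.
  by [].
have afd : adm p (finite_diff r h (f \_ Omega)).
  by rewrite finite_diffE; exact: adm_mdiff.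
have agh (i : 'I_r) : adm p (k i \*o (fun y => g (y + h *+ i.+1))).
  by apply: admZ; exact: adm_shift.
apply: HK4 => //; first by apply: admB => //; exact: adm_sum.
apply: HK3 => //; first exact: adm_sum.
  apply: le_trans (gauge_direction u af Exi).
  exact: gauge_subset.
apply: (HK2 U (fun i => k i \*o (fun y => g (y + h *+ i.+1)))) => // i.
apply: HK1 => //; first exact: adm_shift.
apply: le_trans (HC i f Q fQ).
rewrite -/g -[leRHS](gauge_shift (h *+ i.+1) (measurable_cube _ _) ag).
apply: gauge_subset => //; last 2 first.
- exact: adm_shift.
- by move=> y Uy; exact: inc.
by apply: measurable_preimage_shift; exact: measurable_cube.
Qed.

Let good_segment (P : (V -> R) -> (V -> R) -> Prop) c s x t :
  (forall f Q, P f Q -> admissible f /\ polydeg r.-1 Q) ->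
  0 < s -> cube c s `<=` Omega -> good P c -> Omega x ->
  0 <= t <= 1 -> good P (c + t *: (x - c)).
Proof.
move=> PP s0 cO gc Ox t01.
have [e [e0 [C HC]]] := gc.
have near_c y : `|y - c| <= e / 2 -> good P y.
  move=> yc; exists (e / 2); split; first by rewrite divr_gt0.
  exists C => f Q fQ; have [af Qr] := PP _ _ fQ; apply: le_trans (HC f Q fQ).
  apply: gauge_subset.
  - by apply: measurableI => //; exact: measurable_cube.
  - by apply: measurableI => //; exact: measurable_cube.
  - by apply: admB; [exact: adm_restrict af.1|exact: adm_polydeg Qr].
  - apply: setSI => w; rewrite /cube /= => wy.
    rewrite -(subrK y w) -addrA; apply: le_trans (ler_normD _ _) _.
    by rewrite [leRHS]splitr lerD.
have xc1 : 0 < `|x - c| + 1 by rewrite ltr_wpDl.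
pose t0 := e / 2 / (`|x - c| + 1).
have t00 : 0 < t0 by rewrite !divr_gt0.
have r2 : 0 < 2 * r%:R :> R by rewrite mulr_gt0// ltr0n.
have H n : forall t, 0 <= t <= 1 -> t <= t0 + n%:R * (t0 / (2 * r%:R)) ->
    good P (c + t *: (x - c)).
  elim: n => [|n IH] {t01}t /andP[t_ge0 t1].
    rewrite mul0r addr0 => tt0; apply: near_c.
    rewrite addrAC subrr add0r normrZ ger0_norm//.
    apply: le_trans (ler_wpM2r (normr_ge0 _) tt0) _.
    rewrite /t0 mulrAC ler_pdivrMr// ler_wpM2l ?divr_ge0 ?ltW//.
    by rewrite ltrDl.
  move=> tn.
  pose h0 := - (t / (2 * r%:R)) *: (x - c).
  apply: (@good_step P _ h0) => // j /andP[j0 jr].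
  pose v := t * (1 - j%:R / (2 * r%:R)).
  have -> : c + t *: (x - c) + h0 *+ j = c + v *: (x - c).
    rewrite -addrA; congr (_ + _); rewrite /h0 -scaler_nat scalerA -scalerDl.
    by congr (_ *: _); rewrite /v; field; rewrite pnatr_eq0 -lt0n.
  have j1 : 1 <= j%:R :> R by rewrite ler1n.
  have jr' : j%:R <= r%:R :> R by rewrite ler_nat.
  have jq1 : (2 * r%:R)^-1 <= j%:R / (2 * r%:R) :> R.
    by rewrite ler_peMl// invr_ge0 ltW.
  have jq2 : j%:R / (2 * r%:R) <= 1 / 2 :> R.
    by rewrite ler_pdivrMr// mulrA divfK// mul1r.
  have q0 : 0 < (2 * r%:R : R)^-1 by rewrite invr_gt0.
  have v0 : 0 <= v by rewrite mulr_ge0//; lra.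
  have v1 : v < 1.
    rewrite /v; have [->|tn0] := eqVneq t 0; first by rewrite mul0r.
    have tt : 0 < t by rewrite lt_neqAle eq_sym tn0.
    apply: lt_le_trans t1; rewrite -[ltRHS]mulr1 ltr_pM2l//; lra.
  split.
    apply: IH; first by rewrite v0 ltW.
    apply: (@le_trans _ _ (t * (1 - (2 * r%:R)^-1))).
      by apply: ler_wpM2l => //; lra.
    move: tn; rewrite -natr1 mulrDl mul1r addrA.
    set w := (2 * r%:R)^-1 in jq1 jq2 q0 *; set T := t0 + _ => tn.
    have Tt0 : t0 <= T by rewrite /T lerDl mulr_ge0// mulr_ge0// ltW.
    have w1 : w <= 1 by lra.
    apply: le_trans (ler_wpM2r _ tn) _; first lra.
    have : 0 <= w * (T - t0) by rewrite mulr_ge0 ?subr_ge0// ltW.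
    have : 0 <= t0 * (w * w) by rewrite mulr_ge0 ?mulr_ge0// ltW.
    nra.
  have vv : 0 < (1 - v) * s by rewrite mulr_gt0// subr_gt0.
  apply/nbhs_ballP; exists ((1 - v) * s) => //= y.
  rewrite mx_norm_ball /ball_ /= distrC => /ltW yv.
  by apply: (@convex_cube _ _ Omega c x s v) => //; rewrite v0.
pose n := Num.bound ((t0 / (2 * r%:R))^-1).
apply: (H n) => //; case/andP: t01 => _ t1; apply: le_trans t1 _.
have w0 : 0 < t0 / (2 * r%:R) by rewrite divr_gt0.
apply: (@le_trans _ _ (n%:R * (t0 / (2 * r%:R)))); last by rewrite lerDr ltW.
rewrite -ler_pdivrMr// mul1r; apply: ltW; apply: archi_boundP.
by rewrite invr_ge0 ltW.
Qed.

Lemma whitney_const_lty : (whitney_const r Omega E p < +oo)%E.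
Proof.
have [c /nbhs_ballP[e /= e0 eO]] : Omega° !=set0 by case: bodyO.
have e20 : 0 < e / 2 by rewrite divr_gt0.
have cO : cube c (e / 2) `<=` Omega.
  move=> y; rewrite /cube /= => ye; apply: eO.
  rewrite mx_norm_ball /ball_ /= distrC; apply: le_lt_trans ye _.
  by rewrite ltr_pdivrMr// ltr_pMr// ltr1n.
have [s [s0 sO] [C HC]] := local_approx e20 cO.
pose P f Q := [/\ admissible f, polydeg r.-1 Q &
  (gauge p (cube c s) (f \_ Omega \- Q)%R <= C%:E)%E].
have PP f Q : P f Q -> admissible f /\ polydeg r.-1 Q by case.
have ga f Q : P f Q -> adm p (f \_ Omega \- Q).
  by move=> [af Qr _]; apply: admB; [exact: adm_restrict af.1|exact: adm_polydeg Qr].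
have gc : good P c.
  exists s; split => //; exists C => f Q fQ; have [_ _ fC] := fQ.
  apply: le_trans fC; apply: gauge_subset.
  - by apply: measurableI => //; exact: measurable_cube.
  - exact: measurable_cube.
  - exact: ga.
  - exact: subIsetl.
have gO x : Omega x -> good P x.
  move=> Ox; rewrite (_ : x = c + 1 *: (x - c)); last by rewrite scale1r subrKC.
  by apply: (@good_segment P c s x 1) => //; rewrite ler01 lexx.
have /choice[eC HeC] x : exists eC : R * R, 0 < eC.1 /\ (Omega x -> forall f Q, P f Q ->
    (gauge p (cube x eC.1 `&` Omega) (f \_ Omega \- Q)%R <= eC.2%:E)%E).
  have [/gO[e' [e'0 [C' HC']]]|nO] := pselect (Omega x); last by exists (1, 0).
  by exists (e', C').
have := compO; rewrite compact_cover => /(_ V Omega (fun x => ball x (eC x).1)).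
move=> [x Ox|x Ox|D DO OD]; first exact: ball_open.
  by exists x => //; apply: ballxx; case: (HeC x).
have [K HK] : exists K : R, forall f Q, P f Q ->
    (gauge p Omega (f \_ Omega \- Q)%R <= K%:E)%E.
  suff [K HK] : exists K : R, forall f Q, P f Q ->
      (gauge p (\big[setU/set0]_(x <- finmap.enum_fset D) (cube x (eC x).1 `&` Omega))
        (f \_ Omega \- Q)%R <= K%:E)%E.
    exists K => f Q fQ; apply: le_trans (HK f Q fQ); apply: gauge_subset => //.
    - apply: bigsetU_measurable => x _; apply: measurableI => //.
      exact: measurable_cube.
    - exact: ga.
    - move=> y Oy; have [x xD xy] := OD y Oy.
      rewrite -bigcup_seq; exists x => //; split => //.
      by move: xy; rewrite mx_norm_ball /ball_ /= distrC => /ltW.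
  have {}DO x : x \in (finmap.enum_fset D) -> Omega x by move=> /DO; rewrite inE.
  elim: (finmap.enum_fset D) DO => [|x l IH] lO.
    by exists 0 => f Q _; rewrite big_nil gauge_set0.
  have [|K HK] := IH; first by move=> y yl; apply: lO; rewrite inE yl orbT.
  exists ((eC x).2 + K) => f Q fQ; rewrite big_cons.
  apply: le_trans (gauge_setU _ _ _) _.
  - by apply: measurableI => //; exact: measurable_cube.
  - apply: bigsetU_measurable => y _; apply: measurableI => //.
    exact: measurable_cube.
  - exact: ga.
  - rewrite EFinD; apply: leeD; last exact: HK.
    by apply: (HeC x).2 => //; apply: lO; rewrite inE eqxx.
have [K' K'oo HK'] := Lp_norm_le_gauge (d := d) K p0.
apply: le_lt_trans K'oo; apply: ge_ereal_sup => _ [f af <-].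
have [Q Qr fQ] := HC f af.
apply: (@le_trans _ _ (Lp_norm Omega p (f \- Q))).
  apply: ereal_inf_lbound; exists Q => //; split.
    exact: polydeg_continuous Qr.
  move=> x xi _; have [q qr qE] := polydeg_line x xi Qr.
  by exists q => //; move: qr; rewrite prednK.
apply: HK'; rewrite (@gauge_eq _ _ p _ _ (f \_ Omega \- Q)); first exact: HK.
by move=> x; rewrite inE => Ox /=; rewrite restrictE.
Qed.
End whitney_finite.

(** * Directions that are not dense *)

Section linear_span.
Context {R : realType} {d : nat} (E : set 'rV[R]_d).
Local Notation V := 'rV[R]_d.

Lemma dir_poly1_cst (Q : V -> R) x : lin_span E = setT -> dir_poly 1 E Q -> Q x = Q 0.
Proof.
move=> Espan [_ Qline].
have step y xi t : E xi -> Q (y + t *: xi) = Q y.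
  move=> Exi; have [q q1 qE] := Qline y xi Exi.
  rewrite qE -[in RHS](addr0 y) -(scale0r xi) qE.
  by rewrite (size1_polyC q1) !hornerC.
have : lin_span E x by rewrite Espan.
move=> [s sE /(@coord_span _ _ _ (in_tuple s)) ->].
suff H (l : seq 'I_(size s)) (a : 'I_(size s) -> R) y :
    Q (y + \sum_(i <- l) a i *: s`_i) = Q y by rewrite -[X in Q X = _]add0r H.
elim: l y => [|i l IH] y; first by rewrite big_nil addr0.
by rewrite big_cons addrA IH step//; apply/sE/mem_nth.
Qed.
End linear_span.

Section cone.
Context {R : realType} {d : nat} (E : set 'rV[R]_d) (xi0 : 'rV[R]_d).
Local Notation V := 'rV[R]_d.
Hypotheses (hE : E `<=` sphere) (xi01 : sphere xi0).
Hypothesis xi0E : ~ closure (E `|` [set - x | x in E]) xi0.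
Implicit Types (x y : V) (t a : R).

Let ell x : R := \sum_i x ord0 i * xi0 ord0 i.

Let ellD x y : ell (x + y) = ell x + ell y.
Proof. by rewrite /ell -big_split; apply: eq_bigr => i _; rewrite mxE mulrDl. Qed.

Let ellZ a x : ell (a *: x) = a * ell x.
Proof. by rewrite /ell mulr_sumr; apply: eq_bigr => i _; rewrite mxE mulrA. Qed.

Let ell_xi0 : ell xi0 = 1.
Proof.
have : 0 <= \sum_i xi0 ord0 i ^+ 2 by apply: sumr_ge0 => i _; exact: sqr_ge0.
by move/sqr_sqrtr; rewrite -/(enorm xi0) (xi01 : enorm xi0 = 1) expr1n => ->.
Qed.

Let ell_continuous : continuous ell.
Proof.
suff H (r : seq 'I_d) : continuous (fun x : V => \sum_(i <- r) x ord0 i * xi0 ord0 i).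
  exact: H.
elim: r => [|i r IH] x.
  by under eq_fun do rewrite big_nil; exact: cst_continuous.
under eq_fun do rewrite big_cons.
apply: (@cvgD R R^o V (nbhs x)); last exact: IH.
by apply: (@cvgM _ _ (nbhs x)); [exact: coord_continuous|exact: cvg_cst].
Qed.

Let cone_width : exists2 rho : R, 0 < rho & forall u xi, E xi ->
  u != 0 -> ~ `|u *: xi - xi0| < rho.
Proof.
have [W /= xiW WE] : exists2 W, nbhs xi0 W & W `&` (E `|` [set - x | x in E]) = set0.
  apply: contrapT => H; apply: xi0E => W xiW; apply/set0P/negP => /eqP WE.
  by apply: H; exists W => //; rewrite setIC.
have norm_cont : (fun v : V => (enorm v)^-1 *: v) @ xi0 --> xi0.
  rewrite -[X in _ --> X]scale1r -invr1 -(xi01 : enorm xi0 = 1).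
  apply: (@cvgZ R V V (nbhs xi0)); last exact: cvg_id.
  apply: (@cvgV _ _ (nbhs xi0)); last exact: enorm_continuous.
  by rewrite (xi01 : enorm xi0 = 1) oner_neq0.
have /nbhs_ballP[rho /= rho0 rhoW] := norm_cont W xiW.
exists rho => // u xi Exi u0 uxi.
have /rhoW : ball xi0 rho (u *: xi) by rewrite mx_norm_ball /ball_ /= distrC.
rewrite /= enormZ (hE Exi) mulr1 scalerA => Wu.
have := WE; rewrite -subset0; apply; split; first exact: Wu.
have [u_gt0|u_le0] := ltP 0 u.
  by left; rewrite gtr0_norm// mulVf// scale1r.
right; exists xi => //.
by rewrite ler0_norm// invrN mulNr mulVf// scaleN1r.
Qed.

Let ray_body delta : set V :=
  [set x | [/\ 0 <= ell x, ell x <= 1 & `|x - ell x *: xi0| <= delta * ell x]].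

Let ray_continuous delta :
  continuous (fun x : V => delta * ell x - `|x - ell x *: xi0|).
Proof.
move=> x; apply: (@cvgB R R^o V (nbhs x)).
  by apply: (@cvgM _ _ (nbhs x)); [exact: cvg_cst|exact: ell_continuous].
apply: (@cvg_norm R V V (nbhs x)).
apply: (@cvgB R V V (nbhs x)); first exact: cvg_id.
by apply: (@cvgZ R V V (nbhs x)); [exact: ell_continuous|exact: cvg_cst].
Qed.

Let ray_convex_body delta : 0 < delta -> convex_body (ray_body delta).
Proof.
move=> delta0; split.
- apply: bounded_closed_compact.
    exists (delta + `|xi0|); split; first exact: num_real.
    move=> M /ltW Mle x [x0 x1 xd]; apply: le_trans Mle.
    rewrite -[x in leLHS](subrK (ell x *: xi0)); apply: le_trans (ler_normD _ _) _.
    apply: lerD; first by apply: le_trans xd _; rewrite ler_piMr// ltW.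
    by rewrite normrZ ger0_norm// ler_piMl.
  rewrite (_ : ray_body delta = (ell @^-1` [set t | 0 <= t]) `&`
     (ell @^-1` [set t | t <= 1]) `&`
     ((fun x => delta * ell x - `|x - ell x *: xi0|) @^-1` [set t | 0 <= t])).
    apply: closedI; first apply: closedI.
    + by apply: (@closed_comp _ _ ell) => [x _|]; [exact: ell_continuous|exact: closed_ge].
    + by apply: (@closed_comp _ _ ell) => [x _|]; [exact: ell_continuous|exact: closed_le].
    + apply: (@closed_comp _ _ (fun x : V => delta * ell x - `|x - ell x *: xi0|))
        => [x _|]; [exact: ray_continuous|exact: closed_ge].
  apply/seteqP; split => x /=; first by move=> [x0 x1 xd]; rewrite subr_ge0.
  by move=> [[x0 x1]]; rewrite subr_ge0.
- move=> x y t; rewrite !inE => -[x0 x1 xd] [y0 y1 yd].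
  have [t0 t1] : 0 <= t%:num /\ t%:num <= 1 by [].
  change (ray_body delta (t%:num *: x + (1 - t%:num) *: y)).
  move: (t%:num) t0 t1 => {}t t0 t1.
  have ellE : ell (t *: x + (1 - t) *: y) = t * ell x + (1 - t) * ell y.
    by rewrite ellD !ellZ.
  have t1' : 0 <= 1 - t by rewrite subr_ge0.
  split; rewrite ellE.
  + by rewrite addr_ge0// mulr_ge0.
  + rewrite -[leRHS](subrK t 1) addrC.
    by apply: lerD; [rewrite ler_piMr|rewrite ler_piMr].
  + have -> : t *: x + (1 - t) *: y - (t * ell x + (1 - t) * ell y) *: xi0 =
        t *: (x - ell x *: xi0) + (1 - t) *: (y - ell y *: xi0).
      by apply/rowP => i; rewrite !mxE; ring.
    apply: le_trans (ler_normD _ _) _; rewrite !normrZ !ger0_norm//.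
    rewrite mulrDr !(mulrCA delta).
    by apply: lerD; exact: ler_wpM2l.
- exists (2^-1 *: xi0); pose x0 : V := 2^-1 *: xi0.
  have l0 : ell x0 = 2^-1 by rewrite ellZ ell_xi0 mulr1.
  have near0 : \forall x \near x0, 0 < ell x.
    apply: (@cvgr_gt R V (nbhs x0) _ ell (ell x0)); first exact: ell_continuous.
    by rewrite l0 invr_gt0.
  have near1 : \forall x \near x0, ell x < 1.
    apply: (@cvgr_lt R V (nbhs x0) _ ell (ell x0)); first exact: ell_continuous.
    by rewrite l0 invf_lt1// ltr1n.
  have neard : \forall x \near x0, 0 < delta * ell x - `|x - ell x *: xi0|.
    apply: (@cvgr_gt R V (nbhs x0) _ _ (delta * ell x0 - `|x0 - ell x0 *: xi0|)).
      exact: ray_continuous.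
    by rewrite l0 subrr normr0 subr0 mulr_gt0// invr_gt0.
  apply: (@filterS _ (nbhs x0) _ _ _ _ (filterI near0 (filterI near1 neard))).
  move=> x [xl0 [xl1]]; rewrite subr_gt0 => xl.
  by split; exact: ltW.
Qed.

Let ell_comparable delta : 0 < delta -> (forall u xi, E xi ->
    u != 0 -> ~ `|u *: xi - xi0| <= 3 * delta) ->
  forall x y u xi, ray_body delta x -> ray_body delta y -> E xi ->
  y = x + u *: xi -> ell y <= 2 * ell x.
Proof.
move=> delta0 far x y u xi [x0 x1 xd] [y0 y1 yd] Exi yE.
rewrite leNgt; apply/negP => xy.
have a0 : 0 < ell y - ell x by rewrite subr_gt0; lra.
set a := ell y - ell x in a0.
apply: (far (u / a) xi Exi).
  rewrite mulf_neq0//; last by rewrite invr_eq0 gt_eqF.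
  apply/eqP => u0.
  by move: xy; rewrite yE u0 scale0r addr0; lra.
have -> : (u / a) *: xi - xi0 = a^-1 *: ((y - ell y *: xi0) - (x - ell x *: xi0)).
  have -> : (u / a) *: xi = a^-1 *: (y - x).
    by rewrite yE addrAC subrr add0r scalerA mulrC.
  rewrite -[X in _ - X]scale1r -(mulVf (lt0r_neq0 a0)) -scalerA -scalerBr.
  by congr (_ *: _); rewrite /a scalerBl; apply/rowP => i; rewrite !mxE; ring.
rewrite normrZ gtr0_norm ?invr_gt0// mulrC ler_pdivrMr//.
apply: le_trans (ler_normB _ _) _.
apply: le_trans (lerD yd xd) _; rewrite -mulrDr -mulrA [leRHS]mulrCA.
by apply: ler_wpM2l; [exact: ltW|rewrite /a; lra].
Qed.

Lemma whitney_const_unbounded : lin_span E = setT ->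
  exists2 Omega, convex_body Omega & whitney_const 1 Omega E +oo = +oo%E.
Proof.
move=> Espan; have [rho rho0 rhoE] := cone_width.
pose delta := rho / 6; have delta0 : 0 < delta by rewrite divr_gt0.
have far u xi : E xi -> u != 0 -> ~ `|u *: xi - xi0| <= 3 * delta.
  move=> Exi u0 H; apply: (rhoE u xi Exi u0); apply: le_lt_trans H _.
  by rewrite /delta; lra.
set Omega := ray_body delta; have bodyO := ray_convex_body delta0.
exists Omega; first exact: bodyO.
have clO : closure Omega = Omega.
  apply/esym/closure_id; apply: compact_closed; first exact: norm_hausdorff.
  by case: bodyO.
have ell0 : ell 0 = 0 by rewrite -(scale0r xi0) ellZ mul0r.
pose f (n : nat) x := ln (ell x + expR (- n%:R)).
have pos n x : Omega x -> 0 < ell x + expR (- n%:R).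
  by move=> [x0 _ _]; rewrite ltr_wpDl ?expR_gt0.
have ln2 : ln 2 <= 1 :> R.
  by rewrite -[2]/(1 + 1); apply: le_ln1Dx; lra.
have ln_close n x y : Omega x -> Omega y -> ell y <= 2 * ell x ->
    f n y - f n x <= 1.
  move=> Ox Oy xy; rewrite lerBlDr; apply: le_trans (lerD ln2 (lexx _)).
  rewrite -lnM ?posrE ?pos// ler_ln ?posrE ?mulr_gt0 ?pos//.
  by have := expR_ge0 (- n%:R : R); lra.
have fLp n : Lp Omega +oo (f n).
  rewrite /Lp eqxx /= clO; apply: continuous_in_subspaceT => x /[!inE] Ox.
  apply: (@continuous_comp _ _ _ (fun x => ell x + expR (- n%:R)) (@ln R)).
    by apply: (@cvgD R R^o V (nbhs x)); [exact: ell_continuous|exact: cvg_cst].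
  exact/continuous_ln/pos.
have fE n : (dir_modulus 1 E (f n) Omega +oo <= 1)%E.
  apply: ge_ereal_sup => _ [xi Exi <-].
  apply: ge_ereal_sup => _ [u _ <-].
  apply/gauge_oo_le => // x Dx.
  have Ox : Omega x by have := Dx 0%N isT; rewrite mulr0n addr0.
  have Oy : Omega (x + u *: xi) by have := Dx 1%N isT; rewrite mulr1n.
  rewrite finite_diffE /= ler_norml lerNl opprB.
  rewrite ln_close ?ln_close//.
    exact: (ell_comparable delta0 far Ox Oy Exi).
  apply: (@ell_comparable delta delta0 far _ _ (- u) xi Oy Ox Exi).
  by rewrite scaleNr addrK.
have fdist n : ((n%:R / 2)%:E <= dir_dist 1 (f n) E Omega +oo)%E.
  apply: le_ereal_inf_tmp => _ [Q QE <-].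
  have Q0 := dir_poly1_cst xi0 Espan QE.
  have O0 : Omega 0 by split; rewrite ell0 ?scale0r ?subrr ?normr0 ?mulr0.
  have O1 : Omega xi0.
    by split; rewrite ell_xi0// scale1r subrr normr0 mulr1 ltW.
  have H x : Omega x -> ((`|f n x - Q x|)%R%:E <= Lp_norm Omega +oo (f n \- Q)%R)%E.
    by move=> Ox; apply: ereal_sup_ubound; right; exists x.
  have := H _ O0; have := H _ O1.
  case: Lp_norm => [w| |]//; rewrite ?leey// !lee_fin Q0.
  rewrite /f ell0 ell_xi0 add0r expRK.
  have : 0 <= ln (1 + expR (- n%:R)) :> R by rewrite ln_ge0// lerDl expR_ge0.
  move=> l0 /ler_normlP[h1 h2] /ler_normlP[h3 h4].
  by rewrite ler_pdivrMr//; lra.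
apply/eqyP => A A0.
have A2 : A <= (Num.bound (2 * A))%:R / 2.
  by rewrite ler_pdivlMr// mulrC; apply: ltW; apply: archi_boundP; rewrite mulr_ge0// ltW.
apply: le_trans (_ : ((Num.bound (2 * A))%:R / 2)%:E <= _)%E; first by rewrite lee_fin.
apply: le_trans (fdist _) _; apply: ereal_sup_ubound.
by exists (f (Num.bound (2 * A))).
Qed.
End cone.

Theorem corollary4p2 (R : realType) (d : nat) (E : set 'rV[R]_d)
    (hd : (2 <= d)%N) (hE : E `<=` sphere) (hspan : lin_span E = setT) :
  (forall (r : nat) (p : \bar R) (Omega : set 'rV[R]_d),
      (1 <= r)%N -> (0 < p)%E -> convex_body Omega ->
      (whitney_const r Omega E p < +oo)%E) <->
  closure (E `|` [set - x | x in E]) = sphere.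
Proof.
split=> [wE|Es r p Omega r1 p0 bodyO]; last first.
  by apply: whitney_const_lty => //; exact: ltnW.
apply/seteqP; split => [x|xi xi1].
  have cS : closed (@sphere R d).
    apply: (@closed_comp _ _ (@enorm R d) [set t | t = 1]); last exact: closed_eq.
    by move=> y _; exact: enorm_continuous.
  have ES : E `|` [set - x | x in E] `<=` sphere.
    by move=> y [/hE//|[w /hE w1 <-]]; rewrite /sphere /= enormN.
  by move=> /(closureS ES); rewrite -(closure_id _).1.
apply: contrapT => xiE.
have [A bodyA wA] := whitney_const_unbounded hE xi1 xiE hspan.
have := wE 1%N +oo%E A isT (ltry 0) bodyA.
by rewrite wA ltxx.
Qed.
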